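(* Let $p$ be a prime, let $G$ be a uniform pro-$p$ group, let $X$ be a finite connected graph with vertex set $\{v_1,\dots,v_m\}$, and let $\alpha\colon S\to G$ be a voltage assignment on $X$. Suppose that the derived graph $X_n$ is connected for every $n\ge 0$. Then \[ \mathrm{Fitt}_\Lambda(\mathrm{Pic}_\infty) = \langle \mathrm{Nrd}(D-A_\alpha^t)\rangle_{I(\Lambda)}, \] an equality of $I(\Lambda)$-submodules of $\varprojlim_n Z(\mathbb{Q}_p[G^{(n)}])$.
   Context: A uniform pro-$p$ group $G$ of dimension $l$ is a finitely generated pro-$p$ group topologically generated by $l$ elements such that, writing $G_n=G^{p^n}$, each $G_{n+1}$ is normal in $G_n$ and $G_n/G_{n+1}\cong(\mathbb{Z}/p\mathbb{Z})^l$. Put $G^{(n)}=G/G_n$, $\Lambda=\mathbb{Z}_p[[G]]$ (completed group ring), $\pi_n\colon\Lambda\to\mathbb{Z}_p[G^{(n)}]$ the projection. Graphs may have multiple edges and loops. Choose an orientation of every edge of $X$; $S$ is the set of the chosen oriented edges, and a voltage assignment is a map $\alpha\colon S\to G$, extended to reversed edges by $\alpha(\bar e)=\alpha(e)^{-1}$; $\alpha_n$ is its composite with $G\to G^{(n)}$. The derived graph $X_n$ has vertex set $V(X)\times G^{(n)}$ and, for each $e\in S$ from $v$ to $v'$ and each $g\in G^{(n)}$, an edge joining $(v,g)$ and $(v',g\alpha_n(e))$; $G^{(n)}$ acts by $h\cdot(v,g)=(v,hg)$. For a finite graph $Y$, $\mathrm{Div}(Y)$ is the free $\mathbb{Z}_p$-module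 on $V(Y)$, $\mathrm{Div}^0(Y)$ the submodule of divisors with coefficient sum $0$, $\mathrm{Pr}(Y)$ the $\mathbb{Z}_p$-span of the divisors $\delta(y)=\sum_{e}(y-w_e)$ ($e$ running over edges at $y$, $w_e$ the other endpoint), $\mathrm{Pic}(Y)=\mathrm{Div}(Y)/\mathrm{Pr}(Y)$ and $J(Y)=\mathrm{Div}^0(Y)/\mathrm{Pr}(Y)$. Here $\mathrm{Pic}_\infty=\varprojlim_n\mathrm{Pic}(X_n)$ (limit along the maps induced by $X_{n+1}\to X_n$), a $\Lambda$-module. $D\in\mathrm{Mat}_{m\times m}(\Lambda)$ is diagonal with entries $\deg(v_i)$ (loops counted twice). $A_\alpha=(\alpha_{ij})$ with $\alpha_{ij}=\sum_{e\in E(v_i,v_j)}\alpha(e)$ for $i\ne j$ (edges oriented from $v_i$ to $v_j$) and $\alpha_{ii}=\sum_{\text{loops } e \text{ at } v_i}(\alpha(e)+\alpha(e)^{-1})$; $A_\alpha^t$ is its transpose. Reduced norms: for a finite group $\Gamma$ and $b\ge1$, $\mathrm{Nrd}_\Gamma\colon\mathrm{Mat}_{b\times b}(\mathbb{Q}_p[\Gamma])\to Z(\mathbb{Q}_p[\Gamma])$ is the reduced norm of the semisimple algebra. Over a splitting field $K$ with $K[\Gamma]\cong\bigoplus_i\mathrm{Mat}_{d_i\times d_i}(K)$, it sends a matrix to the tuple of determinants of its components. For $M\in\mathrm{Mat}_{b\times b}(\Lambda)$, $\mathrm{Nrd}(M)=(\mathrm{Nrd}_{G^{(n)}}(\pi_n(M)))_n\in\varprojlim_n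 Z(\mathbb{Q}_p[G^{(n)}])$. $I(\mathbb{Z}_p[G^{(n)}])$ is the $Z(\mathbb{Z}_p[G^{(n)}])$-submodule of $\mathbb{Q}_p[G^{(n)}]$ generated by all $\mathrm{Nrd}(H)$ for $H\in\mathrm{Mat}_{b\times b}(\mathbb{Z}_p[G^{(n)}])$, $b\ge1$; it is a ring. $I(\Lambda)=\varprojlim_n I(\mathbb{Z}_p[G^{(n)}])$. For a finitely generated $\Lambda$-module $N$, $\mathrm{Fitt}_\Lambda(N)$ is the $I(\Lambda)$-submodule generated by $\mathrm{Nrd}(H)$, where $H$ runs over all $b\times b$ submatrices of the matrices of all finite presentations $\Lambda^a\to\Lambda^b\to N\to0$ (presentations with $b>a$ contribute $0$). $\langle x\rangle_{I(\Lambda)}=I(\Lambda)x$.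
   Formalization: For non-commutative G the equality fails with the usual Nrd; here presentation matrices use the column convention for left modules and Nrd(M) is the reduced norm of the corresponding endomorphism, i.e. the usual Nrd of the transpose of M, so the generator is the usual Nrd(D − A_α). *)

(* Defs.v *)
From HB Require Import structures.
From mathcomp Require Import all_boot all_order all_algebra all_fingroup.
From mathcomp Require Import fraction generic_quotient ring_quotient.
From mathcomp Require Import boolp classical_sets functions cardinality topology.

Set Implicit Arguments.
Unset Strict Implicit.
Unset Printing Implicit Defensive.

Import GRing.Theory.
Local Open Scope ring_scope.

(* A p-adic integer is the system of its residues modulo the p ^ n.
   The primality proof is a parameter of the type so that padicZ is canonically
   an integral domain. *)
Record padicZ (p : nat) (p_pr : prime p) := MkPadicZ {
  residue :> nat -> nat;
  residueP : forall n, residue n = (residue n.+1 %% p ^ n)%N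
}.

Section ZpTheory.
Variables (p : nat) (p_pr : prime p).
Local Notation Z := (padicZ p_pr).
Implicit Types x y z : Z.
Local Open Scope nat_scope.

HB.instance Definition _ := gen_eqMixin Z.
HB.instance Definition _ := gen_choiceMixin Z.

Lemma padicZ_eq x y : residue x =1 residue y -> x = y.
Proof.
case: x y => [x xP] [y yP] /= /funext exy; subst y.
by congr MkPadicZ; apply: Prop_irrelevance.
Qed.

Lemma residue_mod x n : x n %% p ^ n = x n.
Proof. by rewrite residueP modn_mod. Qed.

Lemma padicZ_of_subproof (f : nat -> nat) :
  (forall n, f n.+1 = f n %[mod p ^ n]) ->
  forall n, f n %% p ^ n = (f n.+1 %% p ^ n.+1) %% p ^ n.
Proof. by move=> fP n; rewrite modn_dvdm ?dvdn_exp2l // fP. Qed.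

Definition padicZ_of f fP : Z := MkPadicZ p_pr (@padicZ_of_subproof f fP).

Lemma residueS x n : x n.+1 = x n %[mod p ^ n].
Proof. by rewrite (residueP x n) modn_mod. Qed.

Lemma padicZ_cst_subproof (c n : nat) : c = c %[mod p ^ n].
Proof. by []. Qed.
Definition padicZ_nat c : Z := padicZ_of (padicZ_cst_subproof c).

Lemma padicZ_add_subproof x y n : x n.+1 + y n.+1 = x n + y n %[mod p ^ n].
Proof. by rewrite -modnDm !residueS modnDm. Qed.
Definition padicZ_add x y : Z := padicZ_of (padicZ_add_subproof x y).

Lemma padicZ_mul_subproof x y n : x n.+1 * y n.+1 = x n * y n %[mod p ^ n].
Proof. by rewrite -modnMm !residueS modnMm. Qed.
Definition padicZ_mul x y : Z := padicZ_of (padicZ_mul_subproof x y).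

Lemma padicZ_lt x n : x n < p ^ n.
Proof. by rewrite -residue_mod ltn_mod expn_gt0 prime_gt0. Qed.

Lemma padicZ_opp_subproof x n : p ^ n.+1 - x n.+1 = p ^ n - x n %[mod p ^ n].
Proof.
apply/eqP; rewrite -(eqn_modDr (x n.+1)) subnK; last exact/ltnW/padicZ_lt.
rewrite -modnDmr residueS modnDmr subnK; last exact/ltnW/padicZ_lt.
by rewrite modnn expnS modnMl.
Qed.
Definition padicZ_opp x : Z := padicZ_of (padicZ_opp_subproof x).

Lemma padicZ_addA : associative padicZ_add.
Proof. by move=> x y z; apply: padicZ_eq => n /=; rewrite modnDml modnDmr addnA. Qed.
Lemma padicZ_addC : commutative padicZ_add.
Proof. by move=> x y; apply: padicZ_eq => n /=; rewrite addnC. Qed.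
Lemma padicZ_add0 : left_id (padicZ_nat 0) padicZ_add.
Proof. by move=> x; apply: padicZ_eq => n /=; rewrite mod0n residue_mod. Qed.
Lemma padicZ_addN : left_inverse (padicZ_nat 0) padicZ_opp padicZ_add.
Proof.
move=> x; apply: padicZ_eq => n /=.
by rewrite modnDml subnK ?modnn ?mod0n //; apply/ltnW/padicZ_lt.
Qed.
HB.instance Definition _ :=
  GRing.isZmodule.Build Z padicZ_addA padicZ_addC padicZ_add0 padicZ_addN.

Lemma padicZ_mulA : associative padicZ_mul.
Proof. by move=> x y z; apply: padicZ_eq => n /=; rewrite modnMml modnMmr mulnA. Qed.
Lemma padicZ_mulC : commutative padicZ_mul.
Proof. by move=> x y; apply: padicZ_eq => n /=; rewrite mulnC. Qed.
Lemma padicZ_mul1 : left_id (padicZ_nat 1) padicZ_mul.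
Proof. by move=> x; apply: padicZ_eq => n /=; rewrite modnMml mul1n residue_mod. Qed.
Lemma padicZ_mulDl : left_distributive padicZ_mul padicZ_add.
Proof.
by move=> x y z; apply: padicZ_eq => n /=; rewrite modnMml modnDml modnDmr mulnDl.
Qed.
Lemma padicZ_1neq0 : padicZ_nat 1 != padicZ_nat 0.
Proof.
apply/eqP => /(congr1 (fun x : Z => x 1%N)) /=.
by rewrite mod0n modn_small // expn1 prime_gt1.
Qed.
HB.instance Definition _ := GRing.Zmodule_isComNzRing.Build Z
  padicZ_mulA padicZ_mulC padicZ_mul1 padicZ_mulDl padicZ_1neq0.

Definition padicZ_unit : {pred Z} := fun x => `[< exists y : Z, (y * x = 1)%R >].
Definition padicZ_inv (x : Z) : Z :=
  if pselect (exists y : Z, (y * x = 1)%R) is left ex then projT1 (cid ex) else x.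

Lemma padicZ_mulVx : {in padicZ_unit, left_inverse (1 : Z)%R padicZ_inv *%R}.
Proof.
move=> x /asboolP ux; rewrite /padicZ_inv; case: pselect => // ex.
exact: projT2 (cid ex).
Qed.
Lemma padicZ_unitPl (x y : Z) : (y * x = 1)%R -> padicZ_unit x.
Proof. by move=> yx; apply/asboolP; exists y. Qed.
Lemma padicZ_inv_out : {in [predC padicZ_unit], padicZ_inv =1 id}.
Proof.
move=> x /negP nux; rewrite /padicZ_inv; case: pselect => // ex.
by case: nux; apply/asboolP.
Qed.
HB.instance Definition _ :=
  GRing.ComNzRing_hasMulInverse.Build Z padicZ_mulVx padicZ_unitPl padicZ_inv_out.

Lemma padicZ_residue_mono x n k : x (k + n) = x n %[mod p ^ n].
Proof.
elim: k => // k IH; rewrite addSn -IH.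
have := congr1 (modn^~ (p ^ n)) (residueS x (k + n)) => /=.
by rewrite !modn_dvdm // dvdn_exp2l ?leq_addl.
Qed.

Lemma padicZ_integral : GRing.integral_domain_axiom Z.
Proof.
move=> x y xy0; apply/norP => -[/eqP x0 /eqP y0].
have nz (z : Z) : z <> 0%R -> exists n, z n != 0.
  move=> z0; apply: contrapT => zn; apply: z0; apply: padicZ_eq => n /=.
  rewrite mod0n; apply/eqP; apply: contrapT => zn0; apply: zn.
  by exists n; apply/negP.
have [[n xn] [m ym]] := (nz _ x0, nz _ y0).
have ndvd (z : Z) i k : z i != 0 -> ~~ (p ^ i %| z (k + i)).
  move=> zi; apply: contra zi => /eqP.
  by rewrite padicZ_residue_mono residue_mod => ->.
have := congr1 (fun z : Z => z (n + m)) xy0 => /=.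
rewrite mod0n => /eqP; apply/negP.
have xnm := ndvd x n m xn; have ynm := ndvd y m n ym.
rewrite addnC in xnm.
have gt0 (a i : nat) : ~~ (p ^ i %| a) -> 0 < a by case: a => //; rewrite dvdn0.
have [ax ay] := (gt0 _ _ xnm, gt0 _ _ ynm).
rewrite -/(dvdn _ _) pfactor_dvdn // ?muln_gt0 ?ax // lognM // -ltnNge.
rewrite pfactor_dvdn // -ltnNge in xnm; rewrite pfactor_dvdn // -ltnNge in ynm.
by rewrite -addnS leq_add // ltnW.
Qed.
HB.instance Definition _ := GRing.ComUnitRing_isIntegral.Build Z padicZ_integral.

End ZpTheory.

Definition padicQ (p : nat) (p_pr : prime p) : fieldType := {fraction padicZ p_pr}.

Definition galg (R : nzRingType) (gT : finGroupType) : Type := {ffun gT -> R}.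

Section GroupAlgebra.
Variables (R : comNzRingType) (gT : finGroupType).
Local Notation A := (galg R gT).
Implicit Types (x y z : A) (g h k : gT).

HB.instance Definition _ := GRing.Zmodule.copy A {ffun gT -> R}.

Definition galg_one : A := [ffun g => (g == 1%g)%:R].
Definition galg_mul x y : A := [ffun g => \sum_h x h * y (h^-1 * g)%g].
Definition galg_scale (c : R) x : A := [ffun g => c * x g].

Lemma galg_mulA : associative galg_mul.
Proof.
move=> x y z; apply/ffunP=> g; rewrite !ffunE.
under [RHS]eq_bigr => h _ do rewrite ffunE big_distrl.
rewrite exchange_big; apply: eq_bigr => k _ /=.
rewrite ffunE big_distrr /= (reindex_inj (mulgI k^-1%g)).
apply: eq_bigr => h _; rewrite mulrA; congr (_ * z _).
by rewrite invMg invgK -!mulgA mulKVg.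
Qed.

Lemma galg_mul1 : left_id galg_one galg_mul.
Proof.
move=> x; apply/ffunP=> g; rewrite ffunE (bigD1 1%g) //= big1 => [|h /negPf hn1].
  by rewrite ffunE eqxx mul1r addr0 invg1 mul1g.
by rewrite ffunE hn1 mul0r.
Qed.

Lemma galg_mulr1 : right_id galg_one galg_mul.
Proof.
move=> x; apply/ffunP=> g; rewrite ffunE (bigD1 g) //= big1 => [|h hng].
  by rewrite ffunE mulVg eqxx mulr1 addr0.
by rewrite ffunE -eq_mulVg1 (negPf hng) mulr0.
Qed.

Lemma galg_mulDl : left_distributive galg_mul +%R.
Proof.
move=> x y z; apply/ffunP=> g; rewrite !ffunE -big_split /=.
by apply: eq_bigr => h _; rewrite ffunE mulrDl.
Qed.

Lemma galg_mulDr : right_distributive galg_mul +%R.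
Proof.
move=> x y z; apply/ffunP=> g; rewrite !ffunE -big_split /=.
by apply: eq_bigr => h _; rewrite ffunE mulrDr.
Qed.

Lemma galg_1neq0 : galg_one != 0.
Proof.
by apply/eqP => /ffunP/(_ 1%g)/eqP; rewrite !ffunE eqxx oner_eq0.
Qed.

HB.instance Definition _ := GRing.Zmodule_isNzRing.Build A
  galg_mulA galg_mul1 galg_mulr1 galg_mulDl galg_mulDr galg_1neq0.

Lemma galg_scaleA c d x : galg_scale c (galg_scale d x) = galg_scale (c * d) x.
Proof. by apply/ffunP=> g; rewrite !ffunE mulrA. Qed.
Lemma galg_scale1 : left_id 1 galg_scale.
Proof. by move=> x; apply/ffunP=> g; rewrite !ffunE mul1r. Qed.
Lemma galg_scaleDr : right_distributive galg_scale +%R.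
Proof. by move=> c x y; apply/ffunP=> g; rewrite !ffunE mulrDr. Qed.
Lemma galg_scaleDl x : {morph galg_scale^~ x : c d / c + d}.
Proof. by move=> c d; apply/ffunP=> g; rewrite !ffunE mulrDl. Qed.
HB.instance Definition _ := GRing.Zmodule_isLmodule.Build R A
  galg_scaleA galg_scale1 galg_scaleDr galg_scaleDl.

Lemma galg_scaleAl (c : R) x y : c *: (x * y) = (c *: x) * y.
Proof.
apply/ffunP=> g; rewrite !ffunE big_distrr /=.
by apply: eq_bigr => h _; rewrite ffunE mulrA.
Qed.
HB.instance Definition _ := GRing.Lmodule_isLalgebra.Build R A galg_scaleAl.

Lemma galg_scaleAr (c : R) x y : c *: (x * y) = x * (c *: y).
Proof.
apply/ffunP=> g; rewrite !ffunE big_distrr /=.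
by apply: eq_bigr => h _; rewrite ffunE mulrCA.
Qed.
HB.instance Definition _ := GRing.Lalgebra_isAlgebra.Build R A galg_scaleAr.

Definition galg_of g : A := [ffun h => (h == g)%:R].

End GroupAlgebra.

Definition galg_push (R : comNzRingType) (gT hT : finGroupType) (f : gT -> hT)
  (x : galg R gT) : galg R hT := [ffun h => \sum_(g | f g == h) x g].

Definition galg_map (R S : comNzRingType) (gT : finGroupType) (f : R -> S)
  (x : galg R gT) : galg S gT := [ffun g => f (x g)].

Definition ring_center (R : pzRingType) : set R :=
  [set z | forall x, z * x = x * z]%classic.

Definition dprod (I : Type) (R : I -> pzRingType) : Type := forall i, R i.

Section DProd.
Variables (I : Type) (R : I -> pzRingType).
Local Notation P := (dprod R).

HB.instance Definition _ := gen_eqMixin P.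
HB.instance Definition _ := gen_choiceMixin P.

Fact dprod_addA : associative (fun x y : P => (fun i => x i + y i) : P).
Proof. by move=> x y z; apply: functional_extensionality_dep => i; apply: addrA. Qed.
Fact dprod_addC : commutative (fun x y : P => (fun i => x i + y i) : P).
Proof. by move=> x y; apply: functional_extensionality_dep => i; apply: addrC. Qed.
Fact dprod_add0 : left_id ((fun i => 0) : P) (fun x y : P => (fun i => x i + y i) : P).
Proof. by move=> x; apply: functional_extensionality_dep => i; apply: add0r. Qed.
Fact dprod_addN : left_inverse ((fun i => 0) : P) (fun x : P => (fun i => - x i) : P)
  (fun x y : P => (fun i => x i + y i) : P).
Proof. by move=> x; apply: functional_extensionality_dep => i; apply: addNr. Qed.
HB.instance Definition _ :=
  GRing.isZmodule.Build P dprod_addA dprod_addC dprod_add0 dprod_addN.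

Fact dprod_mulA : associative (fun x y : P => (fun i => x i * y i) : P).
Proof. by move=> x y z; apply: functional_extensionality_dep => i; apply: mulrA. Qed.
Fact dprod_mul1 : left_id ((fun i => 1) : P) (fun x y : P => (fun i => x i * y i) : P).
Proof. by move=> x; apply: functional_extensionality_dep => i; apply: mul1r. Qed.
Fact dprod_mulr1 : right_id ((fun i => 1) : P) (fun x y : P => (fun i => x i * y i) : P).
Proof. by move=> x; apply: functional_extensionality_dep => i; apply: mulr1. Qed.
Fact dprod_mulDl : left_distributive (fun x y : P => (fun i => x i * y i) : P) +%R.
Proof. by move=> x y z; apply: functional_extensionality_dep => i; apply: mulrDl. Qed.
Fact dprod_mulDr : right_distributive (fun x y : P => (fun i => x i * y i) : P) +%R.
Proof. by move=> x y z; apply: functional_extensionality_dep => i; apply: mulrDr. Qed.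
HB.instance Definition _ := GRing.Zmodule_isPzRing.Build P
  dprod_mulA dprod_mul1 dprod_mulr1 dprod_mulDl dprod_mulDr.

End DProd.

Local Open Scope classical_set_scope.

HB.mixin Record isTopologicalGroup G of Topological G & monoid.Group G := {
  mulg_continuous : continuous (fun xy : G * G => (xy.1 * xy.2)%g);
  invg_continuous : continuous (fun x : G => (x^-1)%g)
}.

#[short(type="topGroupType")]
HB.structure Definition TopologicalGroup :=
  {G of Topological G & monoid.Group G & isTopologicalGroup G}.

HB.mixin Record isProfinite G of TopologicalGroup G := {
  profinite_compact : compact [set: G];
  profinite_hausdorff : hausdorff_space G;
  profinite_disconnected : totally_disconnected [set: G]
}.

#[short(type="profiniteGroupType")]
HB.structure Definition ProfiniteGroup :=
  {G of TopologicalGroup G & isProfinite G}.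

Section Subgroups.
Variable G : topGroupType.
Implicit Types (H N A : set G) (g x y : G).

Definition is_subgroup H :=
  [/\ H 1%g, (forall x y, H x -> H y -> H (x * y)%g) &
      (forall x, H x -> H (x^-1)%g)].

Definition normal_in N H :=
  [/\ is_subgroup N, N `<=` H & forall h x, H h -> N x -> N (x ^ h)%g].

Definition lcoset_of N g : set G := [set (g * x)%g | x in N].

Definition quotient_set H N : set (set G) := lcoset_of N @` H.

Definition quotient_isog H N (B : zmodType) :=
  exists f : set G -> B, set_bij (quotient_set H N) [set: B] f /\
    forall g h, H g -> H h ->
      f (lcoset_of N (g * h)%g) = f (lcoset_of N g) + f (lcoset_of N h).

Definition closed_gen A : set G :=
  [set x | forall H, is_subgroup H -> closed H -> A `<=` H -> H x].

Definition power_subgroup (p n : nat) : set G :=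
  closed_gen [set (x ^+ (p ^ n)%N)%g | x in [set: G]].

Lemma lmulg_continuous g : continuous (fun x => (g * x)%g).
Proof.
move=> x; apply: (@continuous2_cvg _ _ _ _ (nbhs x) _ (fun=> g) id
  (fun a b : G => (a * b)%g) g x) => //.
- exact: (@mulg_continuous G (g, x)).
- exact: cvg_cst.
Qed.

Lemma rmulg_continuous g : continuous (fun x => (x * g)%g).
Proof.
move=> x; apply: (@continuous2_cvg _ _ _ _ (nbhs x) _ id (fun=> g)
  (fun a b : G => (a * b)%g) x g) => //.
- exact: (@mulg_continuous G (x, g)).
- exact: cvg_cst.
Qed.

Lemma conjg_continuous g : continuous (fun x => (x ^ g)%g).
Proof.
move=> x; apply: (@continuous_comp _ _ _ (fun y => (y * g)%g)
  (fun y => (g^-1 * y)%g)).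
  exact: rmulg_continuous.
exact: lmulg_continuous.
Qed.

Lemma lcoset_ofE N g : lcoset_of N g = (fun x => (g^-1 * x)%g) @^-1` N.
Proof.
apply/seteqP; split=> [_ [x Nx <-]|x /= Nx]; first by rewrite /= mulKg.
by exists (g^-1 * x)%g => //; rewrite mulKVg.
Qed.

Lemma closed_lcoset N g : closed N -> closed (lcoset_of N g).
Proof.
rewrite lcoset_ofE => cN.
exact: (preimage_closed (fun x _ => @lmulg_continuous g^-1%g x) cN).
Qed.

Lemma open_lcoset N g : open N -> open (lcoset_of N g).
Proof.
rewrite lcoset_ofE => oN.
by apply: open_comp oN => x _; apply: lmulg_continuous.
Qed.

Lemma closed_gen_sub A : A `<=` closed_gen A.
Proof. by move=> x Ax H _ _; apply. Qed.

Lemma closed_gen_subgroup A : is_subgroup (closed_gen A).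
Proof.
split=> [H []//|x y Kx Ky H sH cH AH|x Kx H sH cH AH].
  by have [_ mH _] := sH; apply: mH; [apply: Kx|apply: Ky].
by have [_ _ iH] := sH; apply: iH; apply: Kx.
Qed.

Lemma closed_closed_gen A : closed (closed_gen A).
Proof.
have -> : closed_gen A =
    \bigcap_(H in [set H | [/\ is_subgroup H, closed H & A `<=` H]]) H.
  apply/seteqP; split=> x Kx H; first by move=> [sH cH AH]; apply: Kx.
  by move=> sH cH AH; apply: Kx.
by apply: closed_bigI => H [].
Qed.

Lemma power_subgroup0 p : power_subgroup p 0 = [set: G].
Proof.
apply/seteqP; split=> // x _; apply: closed_gen_sub.
by exists x; rewrite ?expg1.
Qed.

Lemma power_subgroup_conj p n g x :
  power_subgroup p n x -> power_subgroup p n (x ^ g)%g.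
Proof.
move=> Kx H sH cH AH.
apply: (Kx ((fun y => (y ^ g)%g) @^-1` H)).
- have [h1 mH iH] := sH; split=> /= [|a b Ha Hb|a Ha].
  + by rewrite conj1g.
  + by rewrite conjMg; apply: mH.
  + by rewrite conjVg; apply: iH.
- exact: (preimage_closed (fun y _ => @conjg_continuous g y) cH).
- by move=> _ [y _ <-] /=; apply: AH; exists (y ^ g)%g => //; rewrite conjXg.
Qed.

End Subgroups.

Record open_normal_subgroup (G : topGroupType) := OpenNormalSubgroup {
  ons_set :> G -> Prop;
  ons_open : open ons_set;
  ons_normal : normal_in ons_set [set: G]
}.

Section Quotient.
Variables (G : topGroupType) (U : open_normal_subgroup G).
Implicit Types x y g : G.

Lemma ons1 : U 1%g. Proof. by have [[]] := ons_normal U. Qed.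
Lemma onsM x y : U x -> U y -> U (x * y)%g.
Proof. by have [[_ m _] _ _] := ons_normal U; apply: m. Qed.
Lemma onsV x : U x -> U (x^-1)%g.
Proof. by have [[_ _ i] _ _] := ons_normal U; apply: i. Qed.
Lemma onsJ x g : U x -> U (x ^ g)%g.
Proof. by have [_ _ c] := ons_normal U; apply: c. Qed.

Definition coset_rel x y := `[< U (x^-1 * y)%g >].

Lemma coset_rel_refl : reflexive coset_rel.
Proof. by move=> x; apply/asboolP; rewrite mulVg; apply: ons1. Qed.
Lemma coset_rel_sym : symmetric coset_rel.
Proof.
by move=> x y; apply/asboolP/asboolP => /onsV; rewrite invMg invgK.
Qed.
Lemma coset_rel_trans : transitive coset_rel.
Proof.
move=> y x z /asboolP Uxy /asboolP Uyz; apply/asboolP.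
by have := onsM Uxy Uyz; rewrite -mulgA mulKVg.
Qed.
Canonical coset_equiv :=
  EquivRel coset_rel coset_rel_refl coset_rel_sym coset_rel_trans.

Definition quo : Type := {eq_quot coset_equiv}%qT.
HB.instance Definition _ := Choice.on quo.

Definition cls (x : G) : quo := \pi_({eq_quot coset_equiv}%qT)%qT x.
Definition rep (c : quo) : G := repr (c : {eq_quot coset_equiv}%qT).

Lemma repK : cancel rep cls. Proof. exact: reprK. Qed.

Lemma clsP x y : cls x = cls y <-> U (x^-1 * y)%g.
Proof. by split=> [/eqmodP/asboolP|Uxy] //; apply/eqmodP/asboolP. Qed.

Lemma rep_cls x : U (x^-1 * rep (cls x))%g.
Proof. by apply/clsP; rewrite repK. Qed.

Definition quo_mul (c d : quo) := cls (rep c * rep d)%g.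
Definition quo_inv (c : quo) := cls (rep c)^-1%g.

Lemma quo_mulE x y : quo_mul (cls x) (cls y) = cls (x * y)%g.
Proof.
symmetry; apply/clsP; rewrite invMg.
have -> : (y^-1 * x^-1 * (rep (cls x) * rep (cls y)) =
  (x^-1 * rep (cls x)) ^ y * (y^-1 * rep (cls y)))%g.
  by rewrite /conjg -!mulgA mulKVg.
by apply: onsM (rep_cls y); apply/onsJ/rep_cls.
Qed.

Lemma quo_invE x : quo_inv (cls x) = cls x^-1%g.
Proof.
symmetry; apply/clsP; rewrite invgK.
have -> : (x * (rep (cls x))^-1 = ((x^-1 * rep (cls x))^-1) ^ x^-1)%g.
  by rewrite /conjg invMg !invgK -!mulgA mulgV mulg1.
by apply/onsJ/onsV/rep_cls.
Qed.

Lemma quo_mulA : associative quo_mul.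
Proof.
move=> a b c; rewrite -(repK a) -(repK b) -(repK c) !quo_mulE.
by rewrite mulgA.
Qed.
Lemma quo_mul1 : left_id (cls 1%g) quo_mul.
Proof. by move=> a; rewrite -(repK a) quo_mulE mul1g. Qed.
Lemma quo_mulr1 : right_id (cls 1%g) quo_mul.
Proof. by move=> a; rewrite -(repK a) quo_mulE mulg1. Qed.
Lemma quo_mulV : left_inverse (cls 1%g) quo_inv quo_mul.
Proof. by move=> a; rewrite -(repK a) quo_invE quo_mulE mulVg. Qed.
Lemma quo_mulVr : right_inverse (cls 1%g) quo_inv quo_mul.
Proof. by move=> a; rewrite -(repK a) quo_invE quo_mulE mulgV. Qed.
HB.instance Definition _ := isGroup.Build quo
  quo_mulA quo_mul1 quo_mulr1 quo_mulV quo_mulVr.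

Lemma clsM x y : cls (x * y)%g = (cls x * cls y)%g.
Proof. by rewrite -quo_mulE. Qed.

End Quotient.

Section FiniteQuotient.
Variables (G : profiniteGroupType) (U : open_normal_subgroup G).

Lemma quo_finite : exists s : seq (quo U), forall c, c \in s.
Proof.
pose T : ptopologicalType := HB.pack (ProfiniteGroup.sort G) (ProfiniteGroup.class G) (isPointed.Build G 1%g).
have : @compact T [set: T] by apply: profinite_compact.
rewrite compact_cover => /(_ G [set: G] (lcoset_of (ons_set U)))[].
- by move=> g _; apply/open_lcoset/ons_open.
- by move=> x _; exists x => //; exists 1%g; [apply: ons1|rewrite mulg1].
move=> D _ cov; exists [seq cls U g | g <- finmap.enum_fset D] => c.
have [g /= Dg] := cov (rep c) Logic.I.
rewrite lcoset_ofE /= => /clsP; rewrite repK => <-.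
by apply: map_f.
Qed.

Definition quo_enum : seq (quo U) := undup (projT1 (cid quo_finite)).

Lemma quo_enumP : Finite.axiom quo_enum.
Proof.
move=> c; rewrite count_uniq_mem ?undup_uniq // mem_undup.
by rewrite (projT2 (cid quo_finite)).
Qed.

Lemma quo_pickleK :
  pcancel (fun c => index c quo_enum) (fun i => onth quo_enum i).
Proof.
move=> c; have cin : c \in quo_enum.
  by rewrite -has_pred1 has_count quo_enumP.
by rewrite onthE (nth_map c) ?index_mem // nth_index.
Qed.
HB.instance Definition _ := Choice_isCountable.Build (quo U) quo_pickleK.
HB.instance Definition _ := isFinite.Build (quo U) quo_enumP.

End FiniteQuotient.

(* The map induced by the identity of G; a homomorphism when U is contained
   in V. *)
Definition quo_proj (G : topGroupType) (U V : open_normal_subgroup G)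
  (c : quo U) : quo V := cls V (rep c).

Definition is_pro (p : nat) (G : profiniteGroupType) :=
  forall U : open_normal_subgroup G, p.-nat #|{: quo U}|.

Definition is_uniform (p l : nat) (G : profiniteGroupType) :=
  [/\ is_pro p G,
      (exists x : 'I_l -> G, closed_gen (range x) = [set: G]) &
      forall n, normal_in (power_subgroup p n.+1) (@power_subgroup G p n) /\
        quotient_isog (@power_subgroup G p n) (power_subgroup p n.+1)
          'rV['F_p]_l].

Section Uniform.
Variables (p l : nat) (G : profiniteGroupType).
Hypothesis hG : is_uniform p l G.
Local Notation Gsub := (@power_subgroup G p).

Lemma power_subgroup_normal n : normal_in (Gsub n) [set: G].
Proof.
split=> //; first exact: closed_gen_subgroup.
by move=> h x _; apply: power_subgroup_conj.
Qed.

Lemma power_subgroup_open n : open (Gsub n).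
Proof.
elim: n => [|n oH]; first by rewrite power_subgroup0; apply: openT.
have [_ _ /(_ n)[[sN NH _] [f [fbij fM]]]] := hG.
set H := Gsub n in oH NH fbij fM *; set N := Gsub n.+1 in sN NH fbij fM *.
have [N1 NM NV] := sN.
have [H1 HM HV] : is_subgroup H by apply: closed_gen_subgroup.
have [_ finj _] := fbij.
pose C a := [set x | H x /\ f (lcoset_of N x) = a].
have cosetP x y : lcoset_of N x = lcoset_of N y <-> N (x^-1 * y)%g.
  split=> [exy|Nxy].
    have : lcoset_of N y y by exists 1%g; rewrite ?mulg1.
    by rewrite -exy lcoset_ofE.
  apply/seteqP; split=> z; rewrite !lcoset_ofE /= => Nz.
    by have := NM _ _ (NV _ Nxy) Nz; rewrite invMg invgK -!mulgA mulKVg.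
  by have := NM _ _ Nxy Nz; rewrite -!mulgA mulKVg.
have Cclosed a : closed (C a).
  have [[x [Hx fx]]|noC] := pselect (exists x, C a x).
    suff -> : C a = lcoset_of N x by apply: closed_lcoset; apply: closed_closed_gen.
    apply/seteqP; split=> y.
      move=> [Hy fy]; rewrite lcoset_ofE; apply/cosetP.
      by apply: finj; [rewrite inE; exists x|rewrite inE; exists y|rewrite fx fy].
    rewrite lcoset_ofE /= => Nxy; split.
      by rewrite -[y](mulKVg x); apply: HM => //; apply: NH.
    by rewrite -(proj2 (cosetP x y) Nxy).
  suff -> : C a = set0 by apply: closed0.
  by apply/seteqP; split=> // x Cx; apply: noC; exists x.
have f1 : f (lcoset_of N 1%g) = 0.
  by have := fM _ _ H1 H1; rewrite mulg1 => /eqP; rewrite -subr_eq subrr => /eqP.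
suff -> : N = H `&` ~` (\bigcup_(a in [set a | a != 0]) C a).
  apply: openI => //; apply: closed_openC.
  by apply: closed_bigcup => //; apply: finite_finset.
apply/seteqP; split=> x.
  move=> Nx; split; first exact: NH.
  move=> [a /= /eqP an0 [_ fx]]; apply: an0; rewrite -fx -f1; congr f.
  by apply/cosetP; rewrite mulg1; apply: NV.
move=> [Hx nx]; have : lcoset_of N 1%g = lcoset_of N x.
  apply: finj; [by rewrite inE; exists 1%g|by rewrite inE; exists x|].
  rewrite f1; apply: contrapT => fx; apply: nx.
  by exists (f (lcoset_of N x)) => //=; apply/eqP => /esym.
by move/cosetP; rewrite invg1 mul1g.
Qed.

Definition Gsub_n (n : nat) : open_normal_subgroup G :=
  OpenNormalSubgroup (power_subgroup_open n) (power_subgroup_normal n).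

Definition Gquo (n : nat) : finGroupType := quo (Gsub_n n).

End Uniform.

Section GalgPush.
Variables (R : comNzRingType) (gT hT : finGroupType) (f : gT -> hT).
Hypothesis fM : forall g k, f (g * k)%g = (f g * f k)%g.
Implicit Types x y : galg R gT.

Lemma galg_pushB x y : galg_push f (x - y) = galg_push f x - galg_push f y.
Proof.
apply/ffunP=> h; rewrite !ffunE -sumrB.
by apply: eq_bigr => g _; rewrite !ffunE.
Qed.

Lemma galg_pushM x y : galg_push f (x * y) = galg_push f x * galg_push f y.
Proof.
have fV g : f (g^-1)%g = (f g)^-1%g.
  apply: (mulgI (f g)); rewrite -fM !mulgV.
  by apply: (mulgI (f 1%g)); rewrite -fM !mulg1.
apply/ffunP=> h; rewrite !ffunE.
under eq_bigr => g _ do rewrite ffunE.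
rewrite exchange_big /= (partition_big f predT) //=; apply: eq_bigr => h' _.
rewrite ffunE big_distrl /=; apply: eq_bigr => k /eqP <-.
rewrite ffunE big_distrr /= (reindex_inj (mulgI k)) /=.
by apply: eq_big => [g|g _]; rewrite ?mulKg // fM -(can2_eq (mulKg _) (mulKVg _)).
Qed.

Lemma galg_push_of g : galg_push f (galg_of R g) = galg_of R (f g).
Proof.
apply/ffunP=> h; rewrite !ffunE big_mkcond (bigD1 g) //= big1 => [|k /negPf kg].
  by rewrite ffunE eqxx addr0 eq_sym; case: (h == f g).
by rewrite ffunE kg if_same.
Qed.

End GalgPush.

Section Lambda.
Variables (p : nat) (p_pr : prime p) (G : profiniteGroupType).
Local Notation fam :=
  (dprod (fun U : open_normal_subgroup G => galg (padicZ p_pr) (quo U))).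

Lemma quo_projE (U V : open_normal_subgroup G) x :
  ons_set U `<=` ons_set V -> quo_proj V (cls U x) = cls V x.
Proof. by move=> UV; symmetry; apply/clsP/UV/rep_cls. Qed.

Lemma quo_projM (U V : open_normal_subgroup G) (c d : quo U) :
  ons_set U `<=` ons_set V ->
  quo_proj V (c * d)%g = (quo_proj V c * quo_proj V d)%g.
Proof.
move=> UV; rewrite -(repK c) -(repK d) -clsM.
by rewrite !quo_projE // clsM.
Qed.

Definition Lambda_compat : {pred fam} := fun x =>
  `[< forall U V : open_normal_subgroup G, ons_set U `<=` ons_set V ->
      galg_push (@quo_proj G U V) (x U) = x V >].

Lemma Lambda_subring : subring_closed Lambda_compat.
Proof.
split=> [|x y /asboolP xP /asboolP yP|x y /asboolP xP /asboolP yP];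
  apply/asboolP => U V UV.
- change (galg_push (@quo_proj G U V) (galg_of (padicZ p_pr) (cls U 1%g)) =
    galg_of (padicZ p_pr) (cls V 1%g)).
  by rewrite galg_push_of quo_projE.
- change (galg_push (@quo_proj G U V) (x U - y U) = x V - y V).
  by rewrite galg_pushB xP // yP.
- change (galg_push (@quo_proj G U V) (x U * y U) = x V * y V).
  rewrite galg_pushM ?xP ?yP // => c d; exact: quo_projM.
Qed.
HB.instance Definition _ :=
  GRing.isSubringClosed.Build fam Lambda_compat Lambda_subring.

Record Lambda := MkLambda {
  Lambda_val :> fam;
  Lambda_valP : Lambda_val \in Lambda_compat
}.
HB.instance Definition _ := [isSub for Lambda_val].
HB.instance Definition _ := [Choice of Lambda by <:].
HB.instance Definition _ := GRing.SubChoice_isSubPzRing.Build fam Lambda_compat Lambda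
  (subringClosedP _).

Lemma Lambda_of_subproof (g : G) :
  ((fun U => galg_of (padicZ p_pr) (cls U g)) : fam) \in Lambda_compat.
Proof. by apply/asboolP => U V UV; rewrite galg_push_of quo_projE. Qed.

Definition Lambda_of (g : G) : Lambda := MkLambda (Lambda_of_subproof g).

End Lambda.

(* A finite multigraph each of whose edges carries a chosen orientation. *)
Record graph (V E : finType) := Graph { source : E -> V; target : E -> V }.

Section Graphs.
Variables (V E : finType) (Y : graph V E).

Definition adjacent : rel V := fun v w =>
  [exists e, ((source Y e == v) && (target Y e == w)) ||
             ((source Y e == w) && (target Y e == v))].

Definition graph_connected :=
  (0 < #|V|)%N /\ forall v w, connect adjacent v w.

Definition degree (v : V) : nat :=
  #|[set e | source Y e == v]%SET| + #|[set e | target Y e == v]%SET|.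

Variables (p : nat) (p_pr : prime p).

Definition Div : Type := {ffun V -> (padicZ p_pr)^o}.
HB.instance Definition _ := GRing.Lmodule.on Div.

Definition pt (v : V) : Div := [ffun w => (w == v)%:R].

(* A loop at y contributes 0, whether counted once or twice. *)
Definition delta (y : V) : Div :=
  \sum_(e | source Y e == y) (pt y - pt (target Y e)) +
  \sum_(e | target Y e == y) (pt y - pt (source Y e)).

Definition Pr : {pred Div} := fun D =>
  `[< exists c : V -> padicZ p_pr, D = \sum_v c v *: delta v >].

Lemma Pr_zmod : zmod_closed Pr.
Proof.
split; first by apply/asboolP; exists (fun=> 0); rewrite big1 // => v; rewrite scale0r.
move=> D D' /asboolP[c ->] /asboolP[c' ->]; apply/asboolP.
exists (fun v => c v - c' v); rewrite -sumrB.
by apply: eq_bigr => v _; rewrite scalerBl.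
Qed.
HB.instance Definition _ := GRing.isZmodClosed.Build Div Pr Pr_zmod.

Lemma PrZ a D : D \in Pr -> a *: D \in Pr.
Proof.
move=> /asboolP[c ->]; apply/asboolP; exists (fun v => a * c v).
by rewrite scaler_sumr; apply: eq_bigr => v _; rewrite scalerA.
Qed.

Lemma Pr_delta v : delta v \in Pr.
Proof.
apply/asboolP; exists (fun w => (w == v)%:R).
rewrite (bigD1 v) //= eqxx scale1r big1 ?addr0 // => w /negPf ->.
by rewrite scale0r.
Qed.

Definition Pic : zmodType := Quotient.quot Pr.
Definition Pic_class (D : Div) : Pic := \pi_(Quotient.quot Pr)%qT D.
Definition Pic_rep (c : Pic) : Div := repr (c : Quotient.quot Pr).

Lemma Pic_repK : cancel Pic_rep Pic_class. Proof. exact: reprK. Qed.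

Lemma Pic_classP D D' : Pic_class D = Pic_class D' <-> D - D' \in Pr.
Proof.
rewrite (Quotient.idealrBE Pr D D').
by split=> [/eqP|/eqP].
Qed.

Lemma Pic_classD D D' : Pic_class (D + D') = Pic_class D + Pic_class D'.
Proof. by rewrite /Pic_class !piE. Qed.

Lemma Pic_class_rep D : Pic_rep (Pic_class D) - D \in Pr.
Proof. by apply/Pic_classP; rewrite Pic_repK. Qed.

End Graphs.
Arguments Pr {V E} Y {p} p_pr _.

Definition Div_push (V W : finType) (p : nat) (p_pr : prime p) (f : V -> W)
  (D : Div V p_pr) : Div W p_pr := [ffun w => \sum_(v | f v == w) D v].

Definition derived_graph (V E : finType) (X : graph V E) (gT : finGroupType)
    (beta : E -> gT) : graph (V * gT)%type (E * gT)%type :=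
  Graph (fun eg => (source X eg.1, eg.2))
        (fun eg => (target X eg.1, eg.2 * beta eg.1)%g).

Definition Pic_push (V E W E' : finType) (Y : graph V E) (Y' : graph W E')
  (p : nat) (p_pr : prime p) (f : V -> W) (c : Pic Y p_pr) : Pic Y' p_pr :=
  Pic_class Y' (Div_push f (Pic_rep c)).

Section GroupAction.
Variables (p : nat) (p_pr : prime p) (V E : finType) (X : graph V E).
Variables (gT : finGroupType) (beta : E -> gT).
Local Notation Y := (derived_graph X beta).
Local Notation D := (Div (V * gT)%type p_pr).
Local Notation A := (galg (padicZ p_pr) gT).

(* The Z_p-linear extension of h . (v, g) = (v, h g). *)
Definition Div_act (a : A) (x : D) : D :=
  [ffun vg => \sum_h a h * x (vg.1, (h^-1 * vg.2)%g)].

Lemma Div_actM a b x : Div_act a (Div_act b x) = Div_act (a * b) x.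
Proof.
apply/ffunP=> -[v g]; rewrite !ffunE /=.
under [RHS]eq_bigr => h _ do rewrite ffunE big_distrl.
rewrite exchange_big; apply: eq_bigr => k _ /=.
rewrite ffunE big_distrr /= (reindex_inj (mulgI k^-1%g)).
apply: eq_bigr => h _; rewrite mulrA; congr (_ * x (_, _)).
by rewrite invMg invgK -!mulgA mulKVg.
Qed.

Lemma Div_act1 x : Div_act 1 x = x.
Proof.
apply/ffunP=> -[v g]; rewrite ffunE (bigD1 1%g) //= big1 => [|h /negPf hn1].
  by rewrite ffunE eqxx mul1r addr0 invg1 mul1g.
by rewrite ffunE hn1 mul0r.
Qed.

Lemma Div_actDr a x y : Div_act a (x + y) = Div_act a x + Div_act a y.
Proof.
apply/ffunP=> -[v g]; rewrite !ffunE -big_split /=.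
by apply: eq_bigr => h _; rewrite ffunE mulrDr.
Qed.

Lemma Div_actDl a b x : Div_act (a + b) x = Div_act a x + Div_act b x.
Proof.
apply/ffunP=> -[v g]; rewrite !ffunE -big_split /=.
by apply: eq_bigr => h _; rewrite ffunE mulrDl.
Qed.

Lemma Div_actZ a c x : Div_act a (c *: x) = c *: Div_act a x.
Proof.
apply/ffunP=> -[v g]; rewrite !ffunE scaler_sumr.
by apply: eq_bigr => h _; rewrite ffunE; apply: mulrCA.
Qed.

Lemma Div_act0 a : Div_act a 0 = 0.
Proof. by have := Div_actZ a 0 0; rewrite !scale0r. Qed.

Lemma Div_actN a x : Div_act a (- x) = - Div_act a x.
Proof. by rewrite -scaleN1r Div_actZ scaleN1r. Qed.

Lemma Div_act_sum a I (r : seq I) (P : pred I) F :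
  Div_act a (\sum_(i <- r | P i) F i) = \sum_(i <- r | P i) Div_act a (F i).
Proof. exact: (big_morph _ (Div_actDr a) (Div_act0 a)). Qed.

Lemma Div_act_pt a v g : Div_act a (pt p_pr (v, g)) =
  \sum_h a h *: pt p_pr (v, (h * g)%g).
Proof.
apply/ffunP=> -[w k]; rewrite ffunE sum_ffunE; apply: eq_bigr => h _ /=.
rewrite !ffunE; congr (_ * (_ : bool)%:R).
by rewrite !xpair_eqE -(can2_eq (mulKVg h) (mulKg h)).
Qed.

Lemma delta_derived v g : delta Y p_pr (v, g) =
  \sum_(e | source X e == v) (pt p_pr (v, g) - pt p_pr (target X e, g * beta e)%g)
  + \sum_(e | target X e == v)
      (pt p_pr (v, g) - pt p_pr (source X e, g * (beta e)^-1)%g).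
Proof.
congr (_ + _).
- rewrite (reindex_onto (fun e => (e, g)) fst) /=; last first.
    by move=> [e k]; rewrite /= xpair_eqE => /andP[_ /eqP->].
  by apply: eq_bigl => e; rewrite xpair_eqE !eqxx !andbT.
- rewrite (reindex_onto (fun e => (e, g * (beta e)^-1)%g) fst) /=; last first.
    by move=> [e k]; rewrite /= xpair_eqE => /andP[_ /eqP<-]; rewrite mulgK.
  by apply: eq_big => [e|e _]; rewrite ?xpair_eqE ?mulgKV ?eqxx ?andbT.
Qed.

Lemma Div_act_delta a v g : Div_act a (delta Y p_pr (v, g)) =
  \sum_h a h *: delta Y p_pr (v, (h * g)%g).
Proof.
rewrite delta_derived Div_actDr !Div_act_sum.
under [RHS]eq_bigr => h _ do rewrite delta_derived scalerDr !scaler_sumr.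
rewrite big_split /=; congr (_ + _); rewrite exchange_big; apply: eq_bigr => e _ /=;
  rewrite Div_actDr Div_actN !Div_act_pt -sumrB; apply: eq_bigr => h _;
  by rewrite scalerBr mulgA.
Qed.

Lemma Div_act_Pr a x : x \in Pr Y p_pr -> Div_act a x \in Pr Y p_pr.
Proof.
move=> /asboolP[c ->]; rewrite Div_act_sum; apply: rpred_sum => -[v g] _.
rewrite Div_actZ; apply: PrZ; rewrite Div_act_delta.
by apply: rpred_sum => h _; apply/PrZ/Pr_delta.
Qed.

Definition Pic_act (a : A) (c : Pic Y p_pr) : Pic Y p_pr :=
  Pic_class Y (Div_act a (Pic_rep c)).

Lemma Pic_actE a x : Pic_act a (Pic_class Y x) = Pic_class Y (Div_act a x).
Proof.
apply/Pic_classP; rewrite -Div_actN -Div_actDr.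
by apply/Div_act_Pr/Pic_class_rep.
Qed.

End GroupAction.

Section PicPush.
Variables (p : nat) (p_pr : prime p) (V E : finType) (X : graph V E).
Variables (gT hT : finGroupType) (f : gT -> hT).
Variables (beta : E -> gT) (beta' : E -> hT).
Hypothesis fbeta : forall e, f (beta e) = beta' e.
Hypothesis fM : forall g k, f (g * k)%g = (f g * f k)%g.
Let F (vg : V * gT) : V * hT := (vg.1, f vg.2).
Local Notation Y := (derived_graph X beta).
Local Notation Y' := (derived_graph X beta').
Local Notation push := (@Div_push _ _ p p_pr F).

Lemma Div_pushD x y : push (x + y) = push x + push y.
Proof.
apply/ffunP=> h; rewrite !ffunE -big_split /=.
by apply: eq_bigr => g _; rewrite !ffunE.
Qed.
Lemma Div_pushZ c x : push (c *: x) = c *: push x.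
Proof.
apply/ffunP=> h; rewrite !ffunE scaler_sumr.
by apply: eq_bigr => g _; rewrite !ffunE.
Qed.
Lemma Div_push0 : push 0 = 0.
Proof. by have := Div_pushZ 0 0; rewrite !scale0r. Qed.
Lemma Div_pushN x : push (- x) = - push x.
Proof. by rewrite -scaleN1r Div_pushZ scaleN1r. Qed.
Lemma Div_push_sum I (r : seq I) (P : pred I) H :
  push (\sum_(i <- r | P i) H i) = \sum_(i <- r | P i) push (H i).
Proof. exact: (big_morph _ Div_pushD Div_push0). Qed.

Lemma Div_push_pt y : push (pt p_pr y) = pt p_pr (F y).
Proof.
apply/ffunP=> w; rewrite !ffunE big_mkcond (bigD1 y) //= big1 => [|k /negPf ky].
  by rewrite ffunE eqxx addr0 eq_sym; case: (w == F y).
by rewrite ffunE ky if_same.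
Qed.

Lemma Div_push_delta y : push (delta Y p_pr y) = delta Y' p_pr (F y).
Proof.
have fV g : f (g^-1)%g = (f g)^-1%g.
  apply: (mulgI (f g)); rewrite -fM !mulgV.
  by apply: (mulgI (f 1%g)); rewrite -fM !mulg1.
case: y => v g; rewrite !delta_derived Div_pushD !Div_push_sum /F /=.
congr (_ + _); apply: eq_bigr => e _;
  by rewrite Div_pushD Div_pushN !Div_push_pt /F /= fM ?fV fbeta.
Qed.

Lemma Div_push_Pr x : x \in Pr Y p_pr -> push x \in Pr Y' p_pr.
Proof.
move=> /asboolP[c ->]; rewrite Div_push_sum; apply: rpred_sum => y _.
by rewrite Div_pushZ Div_push_delta; apply/PrZ/Pr_delta.
Qed.

Lemma Div_push_act a x :
  push (Div_act a x) = Div_act (galg_push f a) (push x).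
Proof.
have -> : x = \sum_y x y *: pt p_pr y.
  apply/ffunP => y; rewrite sum_ffunE (bigD1 y) //= big1 => [|z /negPf zy].
    by rewrite !ffunE eqxx addr0; symmetry; apply: mulr1.
  by rewrite !ffunE eq_sym zy; apply: mulr0.
rewrite !(Div_act_sum, Div_push_sum); apply: eq_bigr => -[v g] _.
rewrite !(Div_actZ, Div_pushZ) Div_push_pt !Div_act_pt Div_push_sum; congr (_ *: _).
rewrite [RHS](eq_bigr (fun h => \sum_(k | f k == h) a k *:
    pt p_pr (v, (h * f g)%g))); last first.
  by move=> h _; rewrite ffunE scaler_suml.
rewrite (partition_big f predT) //=; apply: eq_bigr => h _; apply: eq_bigr => k /eqP <-.
by rewrite Div_pushZ Div_push_pt /F /= fM.
Qed.

Lemma Pic_pushE x :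
  Pic_push Y' F (Pic_class Y x) = Pic_class Y' (push x).
Proof.
apply/Pic_classP; rewrite -Div_pushN -Div_pushD.
by apply/Div_push_Pr/Pic_class_rep.
Qed.

End PicPush.

Section PicInfty.
Variables (p : nat) (p_pr : prime p) (l : nat) (G : profiniteGroupType).
Variable hG : is_uniform p l G.
Variables (V E : finType) (X : graph V E) (alpha : E -> G).

Definition voltage_cover (n : nat) :=
  derived_graph X (fun e => cls (Gsub_n hG n) (alpha e) : Gquo hG n).
Local Notation X_ := voltage_cover.

Definition Gquo_proj (n : nat) : Gquo hG n.+1 -> Gquo hG n :=
  @quo_proj G (Gsub_n hG n.+1) (Gsub_n hG n).

Definition cover_proj (n : nat) (y : V * Gquo hG n.+1) : V * Gquo hG n :=
  (y.1, Gquo_proj y.2).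

Definition Lambda_proj (n : nat) (a : Lambda p_pr G) :
  galg (padicZ p_pr) (Gquo hG n) := Lambda_val a (Gsub_n hG n).

Record Pic_infty := MkPicInfty {
  Pic_comp :> forall n, Pic (X_ n) p_pr;
  Pic_compP : forall n, Pic_push (X_ n) (@cover_proj n) (Pic_comp n.+1) = Pic_comp n
}.

HB.instance Definition _ := gen_eqMixin Pic_infty.
HB.instance Definition _ := gen_choiceMixin Pic_infty.

Lemma Pic_infty_eq (c d : Pic_infty) : (forall n, c n = d n) -> c = d.
Proof.
case: c d => [c cP] [d dP] /= cd.
have {}cd : c = d by apply: functional_extensionality_dep.
by subst d; congr MkPicInfty; apply: Prop_irrelevance.
Qed.

Lemma Gsub_sub n : ons_set (Gsub_n hG n.+1) `<=` ons_set (Gsub_n hG n).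
Proof. by have [_ _ /(_ n)[[_ sub _] _]] := hG. Qed.

Lemma Gquo_projM n (g k : Gquo hG n.+1) :
  Gquo_proj (g * k)%g = (Gquo_proj g * Gquo_proj k)%g.
Proof. by apply: quo_projM; apply: Gsub_sub. Qed.

Lemma Gquo_proj_cls n x : Gquo_proj (cls (Gsub_n hG n.+1) x) = cls (Gsub_n hG n) x.
Proof. by apply: quo_projE; apply: Gsub_sub. Qed.

Lemma cover_pushE n (x : Div _ p_pr) :
  Pic_push (X_ n) (@cover_proj n) (Pic_class (X_ n.+1) x) =
  Pic_class (X_ n) (Div_push (@cover_proj n) x).
Proof.
apply: Pic_pushE => [e|]; [exact: Gquo_proj_cls|exact: Gquo_projM].
Qed.

Lemma Pic_infty_add_subproof (c d : Pic_infty) n :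
  Pic_push (X_ n) (@cover_proj n) (c n.+1 + d n.+1) = c n + d n.
Proof.
rewrite -(Pic_compP c n) -(Pic_compP d n) -(Pic_repK (c n.+1)) -(Pic_repK (d n.+1)).
by rewrite -Pic_classD !cover_pushE Div_pushD Pic_classD.
Qed.
Definition Pic_infty_add c d := MkPicInfty (Pic_infty_add_subproof c d).

Lemma Pic_class0 n : Pic_class (X_ n) 0 = 0 :> Pic (X_ n) p_pr.
Proof.
by apply: (addrI (Pic_class (X_ n) 0)); rewrite -Pic_classD !addr0.
Qed.
Lemma Pic_classN n (x : Div _ p_pr) : Pic_class (X_ n) (- x) = - Pic_class (X_ n) x.
Proof.
apply: (addrI (Pic_class (X_ n) x)).
by rewrite -Pic_classD !subrr Pic_class0.
Qed.

Lemma Pic_infty_zero_subproof n :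
  Pic_push (X_ n) (@cover_proj n) (0 : Pic (X_ n.+1) p_pr) = 0.
Proof. by rewrite -Pic_class0 cover_pushE Div_push0 Pic_class0. Qed.
Definition Pic_infty_zero := MkPicInfty Pic_infty_zero_subproof.

Lemma Pic_infty_opp_subproof (c : Pic_infty) n :
  Pic_push (X_ n) (@cover_proj n) (- c n.+1) = - c n.
Proof.
rewrite -(Pic_compP c n) -(Pic_repK (c n.+1)).
by rewrite -Pic_classN !cover_pushE Div_pushN Pic_classN.
Qed.
Definition Pic_infty_opp c := MkPicInfty (Pic_infty_opp_subproof c).

Lemma Pic_infty_addA : associative Pic_infty_add.
Proof. by move=> a b c; apply: Pic_infty_eq => n; apply: addrA. Qed.
Lemma Pic_infty_addC : commutative Pic_infty_add.
Proof. by move=> a b; apply: Pic_infty_eq => n; apply: addrC. Qed.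
Lemma Pic_infty_add0 : left_id Pic_infty_zero Pic_infty_add.
Proof. by move=> a; apply: Pic_infty_eq => n; apply: add0r. Qed.
Lemma Pic_infty_addN : left_inverse Pic_infty_zero Pic_infty_opp Pic_infty_add.
Proof. by move=> a; apply: Pic_infty_eq => n; apply: addNr. Qed.
HB.instance Definition _ := GRing.isZmodule.Build Pic_infty
  Pic_infty_addA Pic_infty_addC Pic_infty_add0 Pic_infty_addN.

Lemma Lambda_projP n (a : Lambda p_pr G) :
  galg_push (@Gquo_proj n) (Lambda_proj n.+1 a) = Lambda_proj n a.
Proof.
have /asboolP aP := Lambda_valP a.
exact: (aP (Gsub_n hG n.+1) (Gsub_n hG n) (@Gsub_sub n)).
Qed.

Definition cover_act (n : nat) (a : galg (padicZ p_pr) (Gquo hG n))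
  (c : Pic (X_ n) p_pr) : Pic (X_ n) p_pr := Pic_act a c.

Lemma cover_actE n a (x : Div _ p_pr) :
  cover_act a (Pic_class (X_ n) x) = Pic_class (X_ n) (Div_act a x).
Proof. exact: Pic_actE. Qed.

Lemma Pic_infty_act_subproof (a : Lambda p_pr G) (c : Pic_infty) n :
  Pic_push (X_ n) (@cover_proj n) (cover_act (Lambda_proj n.+1 a) (c n.+1)) =
  cover_act (Lambda_proj n a) (c n).
Proof.
rewrite -(Pic_compP c n) -(Pic_repK (c n.+1)) cover_actE !cover_pushE cover_actE.
rewrite -(Lambda_projP n); congr Pic_class.
exact: (Div_push_act (@Gquo_projM n)).
Qed.
Definition Pic_infty_act a c : Pic_infty :=
  MkPicInfty (Pic_infty_act_subproof a c).

Lemma Pic_infty_actA a b c :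
  Pic_infty_act a (Pic_infty_act b c) = Pic_infty_act (a * b) c.
Proof.
apply: Pic_infty_eq => n /=; rewrite -(Pic_repK (c n)) !cover_actE.
by rewrite Div_actM.
Qed.
Lemma Pic_infty_act1 : left_id 1 Pic_infty_act.
Proof.
move=> c; apply: Pic_infty_eq => n /=; rewrite -(Pic_repK (c n)) !cover_actE.
by rewrite Div_act1.
Qed.
Lemma Pic_infty_actDr : right_distributive Pic_infty_act +%R.
Proof.
move=> a c d; apply: Pic_infty_eq => n /=.
rewrite -(Pic_repK (c n)) -(Pic_repK (d n)) -Pic_classD !cover_actE.
by rewrite Div_actDr Pic_classD.
Qed.
Lemma Pic_infty_actDl c : {morph Pic_infty_act^~ c : a b / a + b}.
Proof.
move=> a b; apply: Pic_infty_eq => n /=.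
rewrite -(Pic_repK (c n)) !cover_actE -Pic_classD.
by rewrite -Div_actDl.
Qed.
HB.instance Definition _ := GRing.Zmodule_isLmodule.Build (Lambda p_pr G) Pic_infty
  Pic_infty_actA Pic_infty_act1 Pic_infty_actDr Pic_infty_actDl.

End PicInfty.

Section VoltageMatrix.
Variables (p : nat) (p_pr : prime p) (G : profiniteGroupType).
Variables (m : nat) (E : finType) (X : graph 'I_m E) (alpha : E -> G).

Definition degree_mx : 'M[Lambda p_pr G]_m :=
  \matrix_(i, j) ((degree X i)%:R *+ (i == j)).

(* The edges oriented from i to j are the e in E from i to j and the reversals
   of the e in E from j to i; for i = j both kinds are counted. *)
Definition voltage_mx : 'M[Lambda p_pr G]_m :=
  \matrix_(i, j)
    (\sum_(e | (source X e == i) && (target X e == j)) Lambda_of p_pr (alpha e) +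
     \sum_(e | (source X e == j) && (target X e == i))
        Lambda_of p_pr (alpha e)^-1%g).

End VoltageMatrix.

(* Matrices of homomorphisms of free left modules follow the column
   convention: H : 'M_(b, a) stands for R^a -> R^b, e_j |-> \sum_i H i j e_i,
   that is x |-> x *m H^T on row vectors. This is the convention under which
   D - A^t is the matrix of the Laplacian v |-> delta v. Composition of
   homomorphisms is then the product of matrices over the converse ring of R,
   so for non-commutative R the transpose matters in determinants too. *)
Definition hom_mx (R : pzRingType) (a b : nat) (H : 'M[R]_(b, a)) : 'M[R]_(a, b) :=
  H^T.

Section ReducedNorm.
Variables (F : fieldType) (gT : finGroupType).

(* phi is the tuple of components of an isomorphism of K-algebras from K[gT]
   onto the product of the 'M[K]_((d i).+1). *)
Definition is_splitting (K : fieldType) (s : nat) (d : 'I_s -> nat)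
    (phi : forall i, {lrmorphism galg K gT -> 'M[K]_((d i).+1)}) : Prop :=
  (forall x, (forall i, phi i x = 0) -> x = 0) /\
  (forall y : forall i, 'M[K]_((d i).+1), exists x, forall i, phi i x = y i).

(* The reduced norm of M as an endomorphism of the free left module of rank b.
   The central element z is unique: it does not depend on the splitting, and it
   is fixed by field automorphisms over F, hence has coefficients in F. *)
Definition is_Nrd (b : nat) (M : 'M[galg F gT]_b) (z : galg F gT) : Prop :=
  ring_center z /\
  forall (K : fieldType) (iota : {rmorphism F -> K}) (s : nat) (d : 'I_s -> nat)
    (phi : forall i, {lrmorphism galg K gT -> 'M[K]_((d i).+1)}),
    is_splitting phi ->
    forall i, phi i (galg_map iota z) =
      (\det (\mxblock_(j < b, k < b) phi i (galg_map iota (hom_mx M j k))))%:M.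

Definition Nrd (b : nat) (M : 'M[galg F gT]_b) : galg F gT := xget 0 (is_Nrd M).

End ReducedNorm.

Definition module_span (R : pzRingType) (C A : set R) : set R :=
  [set x | exists k (c y : 'I_k -> R),
    [/\ forall i, C (c i), forall i, A (y i) & x = \sum_i c i * y i]].

Section FittingInvariant.
Variables (p : nat) (p_pr : prime p) (l : nat) (G : profiniteGroupType).
Variable hG : is_uniform p l G.
Local Notation L := (Lambda p_pr G).

Definition to_padicQ (gT : finGroupType) (x : galg (padicZ p_pr) gT) :
  galg (padicQ p_pr) gT := galg_map (@tofrac (padicZ p_pr)) x.

Definition I_fin (gT : finGroupType) : set (galg (padicQ p_pr) gT) :=
  module_span (@to_padicQ gT @` @ring_center (galg (padicZ p_pr) gT))
    [set z | exists b (H : 'M[galg (padicZ p_pr) gT]_b),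
       (0 < b)%N /\ z = Nrd (map_mx (@to_padicQ gT) H)].

(* The limit of the centers of the Q_p[G / G_n] and all its submodules below are
   subsets of this product. *)
Definition lim_ambient : pzRingType := dprod (fun n => galg (padicQ p_pr) (Gquo hG n)).

Definition I_Lambda : set lim_ambient :=
  [set z | forall n, @I_fin (Gquo hG n) (z n) /\
    galg_push (@Gquo_proj _ _ _ hG n) (z n.+1) = z n].

Definition Nrd_Lambda (b : nat) (M : 'M[L]_b) : lim_ambient :=
  fun n => Nrd (map_mx (fun x => to_padicQ (Lambda_proj hG n x)) M).

Definition presents (N : lmodType L) (a b : nat) (H : 'M[L]_(b, a)) : Prop :=
  exists f : {linear 'rV[L]_b -> N},
    (forall z, exists y, f y = z) /\
    (forall y, f y = 0 <-> exists x : 'rV[L]_a, y = x *m hom_mx H).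

Definition Fitt (N : lmodType L) : set lim_ambient :=
  module_span I_Lambda [set z | exists a b (H : 'M[L]_(b, a)) (f : 'I_b -> 'I_a),
    [/\ (0 < b)%N, presents N H, {homo f : i j / (i < j)%N} &
        z = Nrd_Lambda (colsub f H)]].

Definition principal_I (x : lim_ambient) : set lim_ambient :=
  [set c * x | c in I_Lambda].

End FittingInvariant.
Arguments Fitt {p p_pr l G} hG N _.
Arguments principal_I {p p_pr l G} hG x _.

(* Main.v *)
Require Import Defs.
From HB Require Import structures.
From mathcomp Require Import all_boot all_order all_algebra all_fingroup.
From mathcomp Require Import fraction qpoly pgroup cyclic mxrepresentation zify.
From mathcomp Require Import boolp classical_sets topology.

Set Implicit Arguments.
Unset Strict Implicit.
Unset Printing Implicit Defensive.

Import GRing.Theory.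
Local Open Scope ring_scope.

(** The Laplacian gives a square presentation of Pic_infty by [D - A^t]: the
    identification of divisors on [X_n] with [Z_p[G_n]^m] turns [delta (v, 1)]
    into a row of [D - A], a class in the limit lifts level by level because
    principal divisors lift, and the solutions of [x (D - A) = y] at the finite
    levels are made compatible by a limit along an ultrafilter.

    For a module with a square presentation [Q] (relations as rows) and a square
    matrix [P] of relations between other generators, lifting each system of
    generators through the other gives [U], [V] and a square matrix [W] with
    [ P 0 ; -V 1 ] = W [ 1 -U ; 0 Q ], so [Nrd P = Nrd W * Nrd Q] and [Nrd W] is
    in [I(Lambda)].

    The reduced norm exists over [F] without Galois descent. Schur orthogonality
    shows that [|G|^-3 \sum_h c(h) c(h^-1)], with [c(h)] the sum of the conjugates
    of [h], acts as [1 / d ^ 2] in every absolutely irreducible representation of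
    degree [d]; interpolation yields central idempotents cutting out the
    representations of a given degree, hence the reduced trace, and Newton's
    identities express determinants by traces of powers. *)

(** * Newton's identities *)

Lemma deriv_prod (R : comNzRingType) (I : finType) (F : I -> {poly R}) :
  (\prod_i F i)^`() = \sum_i (F i)^`() * \prod_(k | i != k) F k.
Proof.
suff gen (r : seq I) : uniq r -> (\prod_(i <- r) F i)^`() =
    \sum_(i <- r) (F i)^`() * \prod_(k <- r | i != k) F k.
  by rewrite gen ?index_enum_uniq.
elim: r => [|a r IH] /=; first by rewrite !big_nil derivC.
case/andP=> ar ur; rewrite !big_cons derivM IH // eqxx /=; congr (_ + _).
  congr (_ * _); rewrite big_seq [RHS]big_seq_cond; apply: eq_bigl => k.
  case: (boolP (k \in r)) => //= kr; apply/esym.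
  by apply: contraNneq ar => ->.
rewrite big_distrr /= !big_seq; apply: eq_bigr => i ir.
rewrite big_cons mulrCA ifT //.
by apply: contraNneq ar => <-.
Qed.

Section Newton.

(** Jacobi's formula: in the Leibniz expansion only the diagonal entries of [X - A] have a nonzero
    derivative, and the terms where the [i]-th entry is differentiated form the [(i, i)]
    cofactor. *)
Lemma deriv_char_poly (R : comNzRingType) n (A : 'M[R]_n) :
  (char_poly A)^`() = \tr (\adj (char_poly_mx A)).
Proof.
rewrite /char_poly /determinant raddf_sum /=.
under eq_bigr => s _.
  have -> : ((-1) ^+ s * \prod_i char_poly_mx A i (s i))^`() =
     \sum_i (-1) ^+ s * ((s i == i)%:R * \prod_(k | i != k) char_poly_mx A k (s k)).
    rewrite -mulr_sumr !mulr_sign.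
    have <- : (\prod_i char_poly_mx A i (s i))^`() =
       \sum_i (s i == i)%:R * \prod_(k | i != k) char_poly_mx A k (s k).
      rewrite deriv_prod; apply: eq_bigr => i _; congr (_ * _).
      by rewrite !mxE derivB derivC subr0 derivMn derivX eq_sym.
    by case: (odd_perm s); rewrite ?derivN.
  over.
rewrite exchange_big /mxtrace; apply: eq_bigr => i _ /=.
rewrite mxE expand_cofactor [RHS]big_mkcond; apply: eq_bigr => s _.
by case: eqP; rewrite ?mul1r // mul0r mulr0.
Qed.

Variables (R : comNzRingType) (n : nat) (A : 'M[R]_n).
Local Notation c k := ((char_poly A)`_k).

(* The coefficients of [\adj (X - A)] are read off [(X - A) * \adj (X - A)] by
   Horner's scheme, and the trace of [\adj (X - A)] is the derivative. *)
Lemma char_poly_newton i :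
  c i *+ i = \sum_(j < n.+1) c (i + j)%N * \tr (A ^+ j).
Proof.
pose B k := map_mx (coefp k) (\adj (char_poly_mx A)).
have BE k : B k = (c k.+1)%:M + A *m B k.+1.
  apply/matrixP => a b.
  have /matrixP/(_ a b)/(congr1 (coefp k.+1)) := mul_mx_adj (char_poly_mx A).
  rewrite !mxE raddf_sum /= coefMn.
  rewrite /char_poly; under eq_bigr => j _.
    rewrite /char_poly_mx !mxE mulrBl coefB mulrnAl coefMn coefXM /= coefCM.
    rewrite mulrb.
    over.
  rewrite sumrB -big_mkcond /= (big_pred1 a) => [|j]; last by rewrite eq_sym.
  move/eqP; rewrite subr_eq => /eqP.
  by move=> ->; congr (_ + _); apply: eq_bigr => j _; rewrite !mxE.
have B0 : A *m B 0%N = - (c 0%N)%:M.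
  apply/matrixP => a b.
  have /matrixP/(_ a b)/(congr1 (coefp 0)) := mul_mx_adj (char_poly_mx A).
  rewrite !mxE raddf_sum /= coefMn.
  rewrite /char_poly; under eq_bigr => j _.
    rewrite /char_poly_mx !mxE mulrBl coefB mulrnAl coefMn coefXM /= coefCM.
    rewrite mul0rn sub0r.
    over.
  rewrite sumrN => <-; rewrite opprK.
  by apply: eq_bigr => j _; rewrite !mxE.
have [M BM] : exists M, forall k, (M <= k)%N -> B k = 0.
  exists (\max_a \max_b size (\adj (char_poly_mx A) a b)) => k Mk.
  apply/matrixP => a b; rewrite [LHS]mxE [RHS]mxE; apply: nth_default.
  apply: leq_trans Mk; apply: leq_trans (leq_bigmax a).
  exact: (leq_bigmax b (F := fun b => size (\adj (char_poly_mx A) a b))).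
(* Horner's scheme unrolled [m] times; the remainder vanishes once [k + m] reaches the degree bound
   [M]. *)
have iter k m : B k = \sum_(j < m) c (k.+1 + j)%N *: A ^+ j + A ^+ m *m B (k + m)%N.
  elim: m => [|m IH]; first by rewrite big_ord0 add0r expr0 mul1mx addn0.
  rewrite {1}IH (BE (k + m)%N) big_ord_recr /= -addrA; congr (_ + _).
  rewrite mulmxDr mul_mx_scalar addSn; congr (_ + _).
  by rewrite mulmxA addnS -[A ^+ m *m A]/(A ^+ m * A) -exprSr.
have iter' k : B k = \sum_(j < n) c (k.+1 + j)%N *: A ^+ j.
  have [Mn|nM] := leqP M n.
    by rewrite (iter k n) BM ?mulmx0 ?addr0 // (leq_trans Mn) ?leq_addl.
  rewrite (iter k M) BM ?leq_addl // mulmx0 addr0.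
  rewrite [RHS](big_ord_widen M (fun j => c (k.+1 + j)%N *: A ^+ j) (ltnW nM)).
  rewrite [RHS]big_mkcond; apply: eq_bigr => j _; case: ifP => // /negbT.
  rewrite -leqNgt => nj; rewrite nth_default ?scale0r //.
  by rewrite size_char_poly addSn ltnS (leq_trans nj) // leq_addl.
case: i => [|i].
  rewrite mulr0n; have := congr1 (mxtrace (n:=n)) B0.
  rewrite iter' mulmx_sumr raddf_sum raddfN /= => /eqP.
  rewrite -subr_eq0 opprK => /eqP E0.
  rewrite -[LHS]E0 big_ord_recl addrC; congr (_ + _).
    by rewrite add0n expr0 -scalemx1 mxtraceZ.
  apply: eq_bigr => j _; rewrite add0n -scalemxAr mxtraceZ.
  by rewrite -[A *m _]/(A * A ^+ j) -exprS.
rewrite -coef_deriv deriv_char_poly /mxtrace coef_sum.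
transitivity (\tr (B i)); first by apply: eq_bigr => a _; rewrite [in RHS]mxE.
rewrite iter' raddf_sum /= big_ord_recr /= nth_default ?mul0r ?addr0.
  by apply: eq_bigr => j _; rewrite mxtraceZ.
by rewrite size_char_poly addSn ltnS leq_addl.
Qed.

End Newton.

(** The recursion determines [e], as [k.+1] is invertible, and the coefficients of the
    characteristic polynomial read from the top satisfy it; the last of them is the determinant up
    to sign. *)
Lemma det_newton (K : fieldType) n (A : 'M[K]_n) (e : nat -> K) :
  (forall k, k.+1%:R != 0 :> K) -> e 0%N = 1 ->
  (forall k, e k.+1 *+ k.+1 = - \sum_(j < k.+1) e j * \tr (A ^+ (k.+1 - j))) ->
  \det A = (-1) ^+ n * e n.
Proof.
move=> char0 e0 eS; have sz := size_char_poly A.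
suff E k : (k <= n)%N -> e k = (char_poly A)`_(n - k).
  by rewrite E // subnn char_poly_det signrMK.
elim/ltn_ind: k => -[|k] IH kn.
  rewrite subn0 e0; have /monicP := char_poly_monic A.
  by rewrite lead_coefE sz.
apply: (mulIf (char0 k)); rewrite !mulr_natr eS.
(* Newton's identity at [n - k.+1] begins with [n] times the coefficient, so the difference leaves
   minus the sum over the positive powers of [A]. *)
have -> : (char_poly A)`_(n - k.+1) *+ k.+1 =
    (char_poly A)`_(n - k.+1) *+ n - (char_poly A)`_(n - k.+1) *+ (n - k.+1).
  by rewrite -mulrnBr ?leq_subr // subKn.
rewrite char_poly_newton [in RHS]big_ord_recl /= addn0 expr0 mxtrace1 mulr_natr.
rewrite opprD addrA subrr.
rewrite sub0r; congr (- _).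
under [RHS]eq_bigr => j _ do rewrite /bump leq0n add1n.
rewrite (big_ord_widen n (fun j => e j * \tr (A ^+ (k.+1 - j))) kn).
rewrite [RHS](bigID (fun j : 'I_n => (j < k.+1)%N)) /= [X in _ = _ + X]big1 ?addr0.
  rewrite -(big_ord_widen n (fun j => e j * \tr (A ^+ (k.+1 - j))) kn).
  rewrite -(big_ord_widen n
    (fun j => (char_poly A)`_(n - k.+1 + j.+1) * \tr (A ^+ j.+1)) kn).
  rewrite (reindex_inj rev_ord_inj) /=; apply: eq_bigr => j _.
  rewrite subSS IH; last 2 first.
  - by rewrite ltnS leq_subr.
  - by rewrite (leq_trans _ kn) // leqW // leq_subr.
  have jk : (j <= k)%N by rewrite -ltnS.
  rewrite subnBA // subSn ?leq_subr // subKn //; congr (_`_ _ * _).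
  by lia.
move=> j; rewrite -leqNgt => kj; rewrite nth_default ?mul0r // sz.
by lia.
Qed.

(** * Determinants of block matrices *)

(** The row and the column permutation have the same sign. The sizes are linked by an equation
    because the index types of the two block layouts below are not convertible. *)
Lemma det_mxsub_inj (R : comPzRingType) n n' (s : 'I_n -> 'I_n') (A : 'M[R]_n') :
  n = n' -> injective s -> \det (mxsub s s A) = \det A.
Proof.
move=> nn'; case: _ / nn' in s A * => s_inj.
have -> : mxsub s s A = row_perm (perm s_inj) (col_perm (perm s_inj) A).
  by apply/matrixP => i j; rewrite !mxE !permE.
rewrite row_permE col_permE !det_mulmx mulrCA !det_perm.
by rewrite odd_permV -expr2 sqrr_sign mulr1.
Qed.

Section BlockDet.
Import tagnat.
Variables (R : comPzRingType) (b b' d : nat).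
Variable (A : 'I_(b + b') -> 'I_(b + b') -> 'M[R]_d).

Lemma det_mxblock_ltrig : (forall i j, A (lshift b' i) (rshift b j) = 0) ->
  \det (\mxblock_(i < b + b', j < b + b') A i j) =
  \det (\mxblock_(i < b, j < b) A (lshift b' i) (lshift b' j)) *
  \det (\mxblock_(i < b', j < b') A (rshift b i) (rshift b j)).
Proof.
move=> A0.
pose l (k : 'I_(\sum_(i < b) d)) : 'I_(\sum_(i < b + b') d) :=
  @Rank _ (fun=> d) (lshift b' (sig1 k)) (sig2 k).
pose r (k : 'I_(\sum_(i < b') d)) : 'I_(\sum_(i < b + b') d) :=
  @Rank _ (fun=> d) (rshift b (sig1 k)) (sig2 k).
(* [s] matches the splitting of the flat index with that of the block index ['I_(b + b')], so that
   the reindexed matrix is a two by two block matrix with zero upper right corner. *)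
pose s k := match split k with inl k => l k | inr k => r k end.
have sz : (\sum_(i < b) d + \sum_(i < b') d = \sum_(i < b + b') d)%N.
  by rewrite !sum_nat_const !card_ord mulnDl.
have sig2E (k : nat) (i : 'I_k) (u : 'I_d) :
    sig2 (@Rank _ (fun=> d) i u) = u by rewrite Rank2K; apply: val_inj.
have RankI k (i i' : 'I_k) (u u' : 'I_d) :
    @Rank _ (fun=> d) i u = @Rank _ (fun=> d) i' u' -> i = i' /\ u = u'.
  move=> /(congr1 val) /= /eqP; rewrite eq_Rank => /andP[/eqP -> /eqP uu'].
  by split=> //; apply: val_inj.
have s_inj : injective s.
  move=> x y; rewrite /s -(splitK x) -(splitK y) !unsplitK.
  case: (split x) => {}x; case: (split y) => {}y /= /RankI[].
  - move/lshift_inj=> e1 e2; congr (lshift _ _).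
    by rewrite -(sig2K x) -(sig2K y); move: (sig2 x) (sig2 y) e2; rewrite e1 => ? ? ->.
  - by move/eqP; rewrite eq_lrshift.
  - by move/eqP; rewrite eq_rlshift.
  - move/rshift_inj=> e1 e2; congr (rshift _ _).
    by rewrite -(sig2K x) -(sig2K y); move: (sig2 x) (sig2 y) e2; rewrite e1 => ? ? ->.
rewrite -(det_mxsub_inj _ sz s_inj).
set M := mxsub _ _ _.
have entry i j u v : (\mxblock_(i < b + b', j < b + b') A i j)
    (@Rank _ (fun=> d) i u) (@Rank _ (fun=> d) j v) = A i j u v.
  by rewrite mxE !sig2E !Rank1K.
rewrite -(submxK M) (_ : ursubmx M = 0); last first.
  apply/matrixP => i j; rewrite [LHS]mxE [LHS]mxE [LHS]mxE /s.
  by rewrite (unsplitK (inl i)) (unsplitK (inr j)) entry A0 !mxE.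
rewrite det_lblock; congr (_ * _); congr determinant; apply/matrixP => i j.
  rewrite [LHS]mxE [LHS]mxE [LHS]mxE /s (unsplitK (inl i)) (unsplitK (inl j)).
  by rewrite entry [RHS]mxE.
rewrite [LHS]mxE [LHS]mxE [LHS]mxE /s (unsplitK (inr i)) (unsplitK (inr j)).
by rewrite entry [RHS]mxE.
Qed.

End BlockDet.

(** * Group algebras and Schur orthogonality *)

Section Galg.
Variables (R : comNzRingType) (gT : finGroupType).
Local Notation A := (galg R gT).
Local Notation of_ := (galg_of R).

Lemma galg_ofM (g h : gT) : of_ (g * h)%g = of_ g * of_ h.
Proof.
apply/ffunP => k; rewrite !ffunE (bigD1 g) //= big1 ?addr0 => [|u ug].
  by rewrite !ffunE eqxx mul1r -(can2_eq (mulKVg g) (mulKg g)).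
by rewrite !ffunE (negPf ug) mul0r.
Qed.

Lemma galg_of1 : of_ 1%g = 1 :> A.
Proof. by apply/ffunP => k; rewrite !ffunE. Qed.

Lemma galg_sumE (x : A) : x = \sum_g x g *: of_ g.
Proof.
apply/ffunP => k; rewrite sum_ffunE (bigD1 k) //= big1 ?addr0 => [|u uk].
  by rewrite !ffunE eqxx mulr1.
by rewrite !ffunE eq_sym (negPf uk) mulr0.
Qed.

Lemma galg_centerP (z : A) :
  (forall g, z * of_ g = of_ g * z) -> ring_center z.
Proof.
move=> zg x; rewrite (galg_sumE x) big_distrr big_distrl /=.
by apply: eq_bigr => g _; rewrite -scalerAr -scalerAl zg.
Qed.

(** At a group element this is its class sum times the order of its centralizer. *)
Definition conj_sum (x : A) : A := \sum_g of_ g * x * of_ g^-1%g.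

Lemma conj_sum_center x : ring_center (conj_sum x).
Proof.
apply: galg_centerP => h; rewrite big_distrl big_distrr /=.
rewrite [RHS](reindex_inj (mulgI h^-1%g)); apply: eq_bigr => g _ /=.
rewrite !mulrA -galg_ofM mulKVg -!mulrA -galg_ofM.
by rewrite invMg invgK.
Qed.
End Galg.

(** * Central elements and Newton's recursion *)

Section Center.
Variable R : pzRingType.
Implicit Types x y : R.
Lemma ring_center0 : ring_center (0 : R).
Proof. by move=> u; rewrite mulr0 mul0r. Qed.
Lemma ring_center1 : ring_center (1 : R).
Proof. by move=> u; rewrite mulr1 mul1r. Qed.
Lemma ring_centerN x : ring_center x -> ring_center (- x).
Proof. by move=> xC u; rewrite mulrN mulNr xC. Qed.
Lemma ring_centerD x y : ring_center x -> ring_center y -> ring_center (x + y).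
Proof. by move=> xC yC u; rewrite mulrDl mulrDr xC yC. Qed.
Lemma ring_centerM x y : ring_center x -> ring_center y -> ring_center (x * y).
Proof. by move=> xC yC u; rewrite -mulrA yC mulrA xC mulrA. Qed.
Lemma ring_center_sum (I : Type) (r : seq I) (P : pred I) (F : I -> R) :
  (forall i, P i -> ring_center (F i)) -> ring_center (\sum_(i <- r | P i) F i).
Proof. by move=> FC; elim/big_ind: _ => //; [exact: ring_center0|exact: ring_centerD]. Qed.
End Center.

Lemma ring_centerZ (R : comNzRingType) (A : algType R) (a : R) (x : A) :
  ring_center x -> ring_center (a *: x).
Proof. by move=> xC u; rewrite -scalerAl -scalerAr xC. Qed.

(* [newton c t n k] is the [k]-th elementary symmetric function, up to sign, in
   terms of the power sums [t], with [c k] in the role of [1 / k]; it is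
   meaningful for [k <= n] only. *)
Fixpoint newton (R : pzRingType) (c t : nat -> R) (n : nat) : nat -> R :=
  if n is n'.+1 then fun k => if (k <= n')%N then newton c t n' k
    else - (c n'.+1 * \sum_(j < n'.+1) newton c t n' j * t (n'.+1 - j)%N)
  else fun=> 1.

Lemma newton_widen (R : pzRingType) (c t : nat -> R) n k :
  (k <= n)%N -> newton c t n k = newton c t k k.
Proof.
elim: n => [|n IH]; first by rewrite leqn0 => /eqP ->.
by rewrite leq_eqVlt => /predU1P[-> //|]; rewrite ltnS => kn /=; rewrite kn IH.
Qed.

Lemma newton_rec (R : pzRingType) (c t : nat -> R) n :
  newton c t n.+1 n.+1 =
  - (c n.+1 * \sum_(j < n.+1) newton c t j j * t (n.+1 - j)%N).
Proof.
rewrite /= ltnn; congr (- (_ * _)); apply: eq_bigr => j _.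
by rewrite newton_widen // -ltnS.
Qed.

Lemma newton_morph (R S : pzRingType) (f : {rmorphism R -> S}) c t c' t' n k :
  (forall i, f (c i) = c' i) -> (forall i, f (t i) = t' i) ->
  f (newton c t n k) = newton c' t' n k.
Proof.
move=> fc ft; elim: n k => [|n IH] k /=; first by rewrite rmorph1.
case: ifP => _; first exact: IH.
rewrite rmorphN rmorphM fc rmorph_sum /=; congr (- (_ * _)).
by apply: eq_bigr => j _; rewrite rmorphM IH ft.
Qed.

Lemma newton_center (R : pzRingType) (c t : nat -> R) n k :
  (forall i, ring_center (c i)) -> (forall i, ring_center (t i)) ->
  ring_center (newton c t n k).
Proof.
move=> cC tC; elim: n k => [|n IH] k /=; first exact: ring_center1.
case: ifP => _; first exact: IH.
apply/ring_centerN/ring_centerM => //; apply: ring_center_sum => j _.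
exact: ring_centerM.
Qed.

(** * Extension of scalars and Schur's lemma *)

Section GalgMap.
Variables (F K : comNzRingType) (iota : {rmorphism F -> K}) (gT : finGroupType).

Fact galg_map_is_additive : zmod_morphism (@galg_map _ _ gT iota).
Proof. by move=> x y; apply/ffunP => g; rewrite !ffunE rmorphB. Qed.
Fact galg_map_is_multiplicative : monoid_morphism (@galg_map _ _ gT iota).
Proof.
split=> [|x y]; apply/ffunP => g; rewrite !ffunE.
  by case: (g == 1%g); rewrite ?rmorph1 ?rmorph0.
rewrite rmorph_sum; apply: eq_bigr => h _.
by rewrite !ffunE rmorphM.
Qed.
HB.instance Definition _ :=
  GRing.isZmodMorphism.Build _ _ (@galg_map _ _ gT iota) galg_map_is_additive.
HB.instance Definition _ :=
  GRing.isMonoidMorphism.Build _ _ (@galg_map _ _ gT iota)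
    galg_map_is_multiplicative.

Lemma galg_mapZ a (x : galg F gT) : galg_map iota (a *: x) = iota a *: galg_map iota x.
Proof. by apply/ffunP => g; rewrite !ffunE rmorphM. Qed.
Lemma galg_map_of (g : gT) : galg_map iota (galg_of F g) = galg_of K g.
Proof. by apply/ffunP => h; rewrite !ffunE; case: (_ == _); rewrite ?rmorph1 ?rmorph0. Qed.
End GalgMap.

(** Commutation with the matrix unit [delta_mx j 0], read at entry [(i, 0)], gives [X i j]. *)
Lemma commute_all_scalar_mx (R : comPzRingType) n (X : 'M[R]_n.+1) :
  (forall Y, X *m Y = Y *m X) -> X = (X 0 0)%:M.
Proof.
move=> XY; apply/matrixP => i j; rewrite [RHS]mxE.
have /matrixP/(_ i 0) := XY (delta_mx j 0); rewrite !mxE.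
rewrite (bigD1 j) //= big1 ?addr0 => [|k /negPf kj]; last by rewrite mxE kj mulr0.
rewrite mxE !eqxx mulr1 => ->.
rewrite (bigD1 0) //= big1 ?addr0 => [|k /negPf kj]; last by rewrite mxE kj andbF mul0r.
by rewrite mxE eqxx andbT mulr_natl.
Qed.

Section Schur.
Variables (K : fieldType) (gT : finGroupType) (d : nat).
Variable psi : {lrmorphism galg K gT -> 'M[K]_d.+1}.
Hypothesis psi_surj : forall y, exists x, psi x = y.
Hypothesis char0 : forall k, k.+1%:R != 0 :> K.
Local Notation rho g := (psi (galg_of K g)).
Local Notation N := (#|{: gT}|%:R : K).
Local Notation D := (d.+1%:R : K).

(** The sum is the image of a central element, so by surjectivity of [psi] it commutes with all
    matrices and is scalar; its trace gives the scalar. *)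
Lemma schur_sum (Y : 'M[K]_d.+1) :
  \sum_g rho g * Y * rho (g^-1)%g = (N * \tr Y / D)%:M.
Proof.
have [x <-] := psi_surj Y.
have -> : \sum_g rho g * psi x * rho (g^-1)%g = psi (conj_sum x).
  by rewrite raddf_sum; apply: eq_bigr => g _ /=; rewrite !rmorphM.
have E : psi (conj_sum x) = (psi (conj_sum x) 0 0)%:M.
  apply: commute_all_scalar_mx => Y'; have [x' <-] := psi_surj Y'.
  by have := congr1 psi (conj_sum_center x x'); rewrite !rmorphM.
rewrite E; congr (_%:M); apply: (mulIf (char0 d)); rewrite divfK //.
rewrite mulr_natr -mxtrace_scalar -E raddf_sum raddf_sum /= mulr_natl -sumr_const.
apply: eq_bigr => g _; rewrite !rmorphM /= mxtrace_mulC -[_ *m _]/(_ * _) mulrA -!rmorphM.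
by rewrite -galg_ofM mulVg galg_of1 mul1r.
Qed.

Lemma schur_norm : \sum_g \tr (rho g) * \tr (rho (g^-1)%g) = N.
Proof.
under eq_bigr => g _.
  rewrite /mxtrace big_distrl /=; under eq_bigr => i _ do rewrite big_distrr /=.
  over.
rewrite exchange_big /=; under eq_bigr => i _ do rewrite exchange_big /=.
(* This is entry [(i, k)] of [schur_sum] at the matrix unit [delta_mx i k]. *)
have E i k : \sum_g rho g i i * rho (g^-1)%g k k = (i == k)%:R * N / D.
  have /matrixP/(_ i k) := schur_sum (delta_mx i k).
  rewrite [X in _ = X]mxE summxE => H.
  transitivity ((N * \tr (delta_mx i k : 'M[K]_d.+1) / D) *+ (i == k)); last first.
    case: eqP => [->|_]; last by rewrite !mul0r.
    rewrite mulr1n mul1r /mxtrace (bigD1 k) //= big1 => [|j /negPf jk].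
      by rewrite mxE !eqxx addr0 mulr1.
    by rewrite mxE jk.
  rewrite -H; apply: eq_bigr => g _.
  rewrite mxE (bigD1 k) //= big1 ?addr0 => [|j /negPf jk]; last first.
    by rewrite mxE big1 ?mul0r // => u _; rewrite mxE jk andbF mulr0.
  congr (_ * _); rewrite mxE (bigD1 i) //= big1 ?addr0 => [|j /negPf jk].
    by rewrite mxE !eqxx mulr1.
  by rewrite mxE jk mulr0.
under eq_bigr => i _.
  rewrite (eq_bigr _ (fun k _ => E i k)) (bigD1 i) //= eqxx mul1r.
  rewrite big1 ?addr0 => [|j /negPf ji]; last first.
    by rewrite eq_sym ji !mul0r.
  over.
by rewrite sumr_const card_ord -[LHS]mulr_natr divfK.
Qed.

(** The images of the group elements span the matrix space, so the square of the degree is at most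
    the group order. Degrees can thus be indexed by ['I_n], with [i] standing for degree [i.+1]. *)
Lemma surj_morph_dim_lt : (d < #|{: gT}|)%N.
Proof.
pose B : 'M[K]_(#|{: gT}|, d.+1 * d.+1) := \matrix_(i < #|{: gT}|) mxvec (rho (enum_val i)).
have : row_full B.
  rewrite -sub1mx; apply/row_subP => k; rewrite row1.
  have [x xE] := psi_surj (vec_mx (delta_mx 0 k)).
  rewrite -(vec_mxK (delta_mx 0 k)) -xE (galg_sumE x) raddf_sum raddf_sum /=.
  apply: summx_sub => g _; rewrite !linearZ /=; apply: scalemx_sub.
  by apply: (eq_row_sub (enum_rank g)); rewrite rowK enum_rankK.
rewrite -col_leq_rank => /leq_trans/(_ (rank_leq_row B)).
by apply: leq_trans; rewrite mulSn leq_addr.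
Qed.
End Schur.

(** * Existence of reduced norms *)

Section BlockMorphism.
Variables (R K : pzRingType) (d : nat) (f : {rmorphism R -> 'M[K]_d.+1}).

Definition block_morph (b : nat) (A : 'M[R]_b) := \mxblock_(j < b, k < b) f (A j k).

Lemma block_morphM b (A B : 'M[R]_b) :
  block_morph (A *m B) = block_morph A *m block_morph B.
Proof.
rewrite mul_mxblock; apply: eq_mxblock => i j.
by rewrite mxE rmorph_sum; apply: eq_bigr => k _; rewrite rmorphM.
Qed.

Lemma block_morph1 b : block_morph (1%:M : 'M[R]_b) = 1%:M.
Proof.
rewrite -mxdiagZ /mxdiag; apply: eq_mxblock => i j.
rewrite mxE; case: eqP => ij; last by rewrite rmorph0.
by rewrite rmorph1 conform_mx_id.
Qed.

Lemma block_morphX b (A : 'M[R]_b) k : block_morph (A ^+ k) = block_morph A ^+ k.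
Proof.
elim: k => [|k IH]; first by rewrite !expr0 block_morph1.
by rewrite !exprS block_morphM IH.
Qed.

Lemma mxtrace_block_morph b (A : 'M[R]_b) : \tr (block_morph A) = \tr (f (\tr A)).
Proof. by rewrite mxtrace_mxblock -[\tr A]/(\sum_i A i i) raddf_sum raddf_sum. Qed.

End BlockMorphism.

Lemma det_block_morph_ltrig (R : pzRingType) (K : comPzRingType) (d : nat)
  (f : {rmorphism R -> 'M[K]_d.+1}) b b' (A : 'M[R]_b) C (B : 'M[R]_b') :
  \det (block_morph f (block_mx A 0 C B)) = \det (block_morph f A) * \det (block_morph f B).
Proof.
rewrite det_mxblock_ltrig => [|i j]; last by rewrite block_mxEur mxE rmorph0.
congr (_ * _); congr determinant; apply: eq_mxblock => i j.
  by rewrite block_mxEul.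
by rewrite block_mxEdr.
Qed.

(** Transposing makes the matrix block lower triangular. Its blocks are then transposes of values of
    [f], which no longer come from a morphism, so the statement for arbitrary blocks is applied. *)
Lemma det_block_morph_utrig (R : pzRingType) (K : comPzRingType) (d : nat)
  (f : {rmorphism R -> 'M[K]_d.+1}) b b' (A : 'M[R]_b) C (B : 'M[R]_b') :
  \det (block_morph f (block_mx A C 0 B)) = \det (block_morph f A) * \det (block_morph f B).
Proof.
have det_tr n (X : 'M[R]_n) : \det (block_morph f X) =
    \det (\mxblock_(j < n, k < n) ((f (X k j))^T)) by rewrite -det_tr tr_mxblock.
rewrite !det_tr det_mxblock_ltrig => [|i j]; last by rewrite block_mxEdl mxE rmorph0 trmx0.
congr (_ * _); congr determinant; apply: eq_mxblock => i j.
  by rewrite block_mxEul.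
by rewrite block_mxEdr.
Qed.

Definition galg_morph (F K : fieldType) (gT : finGroupType) d (iota : {rmorphism F -> K})
    (psi : {lrmorphism galg K gT -> 'M[K]_d.+1}) : {rmorphism galg F gT -> 'M[K]_d.+1} :=
  (psi \o galg_map iota).
Arguments galg_morph : simpl never.

Lemma galg_morphE (F K : fieldType) (gT : finGroupType) d (iota : {rmorphism F -> K})
    (psi : {lrmorphism galg K gT -> 'M[K]_d.+1}) x :
  galg_morph iota psi x = psi (galg_map iota x).
Proof. by []. Qed.

(* Testing against all surjections onto matrix algebras, instead of against the
   components of splittings, makes the property pass to quotient groups. *)
Definition is_Nrd_all (F : fieldType) (gT : finGroupType) (b : nat)
    (M : 'M[galg F gT]_b) (z : galg F gT) : Prop :=
  ring_center z /\
  forall (K : fieldType) (iota : {rmorphism F -> K}) d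
    (psi : {lrmorphism galg K gT -> 'M[K]_d.+1}),
    (forall y, exists x, psi x = y) ->
    galg_morph iota psi z = (\det (block_morph (galg_morph iota psi) (hom_mx M)))%:M.

Section NrdExists.
Variables (F : fieldType) (gT : finGroupType).
Hypothesis char0 : forall k, k.+1%:R != 0 :> F.
Local Notation A := (galg F gT).
Local Notation n := #|{: gT}|.

Lemma card_group_gt0 : (0 < n)%N. Proof. by apply/card_gt0P; exists 1%g. Qed.

Definition casimir : A :=
  (n%:R ^- 3) *: \sum_h conj_sum (galg_of F h) * conj_sum (galg_of F h^-1%g).

(** The scalar by which [casimir] acts in degree [i.+1]; these are the interpolation nodes. *)
Definition inv_sqr (i : nat) : F := i.+1%:R ^- 2.

Definition lagrange_poly (i : 'I_n) : {poly F} := tnth (n.-lagrange inv_sqr) i.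

(* The central idempotent of the representations of degree [i.+1]. *)
Definition degree_idem (i : 'I_n) : A :=
  \sum_(j < size (lagrange_poly i)) (lagrange_poly i)`_j *: casimir ^+ j.

(** The central element acting as [d] in each representation of degree [d]; in [red_trace] it
    cancels the denominator left by [conj_sum]. *)
Definition degree_elt : A := \sum_(i < n) (i.+1)%:R *: degree_idem i.

Definition red_trace (x : A) : A := (n%:R^-1) *: (degree_elt * conj_sum x).

(** In degree [i.+1] the matrix [M] becomes a matrix over the field of size [b * i.+1], whose
    determinant is a Newton expression in the reduced traces of its powers; the idempotents glue the
    degrees together. *)
Definition Nrd_newton b (M : 'M[A]_b) : A :=
  \sum_(i < n) degree_idem i * ((-1) ^+ (b * i.+1) *
    newton (fun k => (k%:R^-1)%:A) (fun k => red_trace (\tr (hom_mx M ^+ k)))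
     (b * i.+1) (b * i.+1)).

Lemma casimir_center : ring_center casimir.
Proof.
apply/ring_centerZ/ring_center_sum => h _.
by apply: ring_centerM; apply: conj_sum_center.
Qed.

Lemma degree_idem_center i : ring_center (degree_idem i).
Proof.
apply: ring_center_sum => j _; apply: ring_centerZ.
elim: (j : nat) => [|k IH]; first exact: ring_center1.
by rewrite exprS; apply: ring_centerM IH; apply: casimir_center.
Qed.

(** Characteristic zero keeps the nodes of distinct degrees distinct, as interpolation requires. *)
Lemma inv_sqr_inj : injective inv_sqr.
Proof.
move=> i j /invr_inj; rewrite -!natrX => /eqP.
have natr_inj k m : (k%:R == m%:R :> F) = (k == m).
  wlog km : k m / (k <= m)%N.
    by move=> H; case/orP: (leq_total k m) => [/H //|/H]; rewrite eq_sym => ->.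
  rewrite eq_sym -subr_eq0 -natrB //.
  have [e|km'] := eqVneq k m; first by rewrite e subnn eqxx.
  have : (0 < m - k)%N by rewrite subn_gt0 ltn_neqAle km'.
  by case: (m - k)%N => // u _; rewrite (negPf (char0 u)).
by rewrite natr_inj eqn_exp2r // => /eqP[].
Qed.

Section Morph.
Variables (K : fieldType) (iota : {rmorphism F -> K}) (d : nat).
Variable psi : {lrmorphism galg K gT -> 'M[K]_d.+1}.
Hypothesis psi_surj : forall y, exists x, psi x = y.
Local Notation Psi := (galg_morph iota psi).

Let char0K k : k.+1%:R != 0 :> K.
Proof. by rewrite -(rmorph_nat iota) fmorph_eq0. Qed.

Lemma galg_morph_conj_sum x : Psi (conj_sum x) = (n%:R * \tr (Psi x) / d.+1%:R)%:M.
Proof.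
rewrite -(schur_sum psi_surj char0K) rmorph_sum; apply: eq_bigr => g _.
by rewrite !rmorphM !galg_morphE !galg_map_of.
Qed.

Lemma galg_morphZ a x : Psi (a *: x) = iota a *: Psi x.
Proof. by rewrite !galg_morphE galg_mapZ linearZ. Qed.

(** The conjugate sum of [h] acts as n chi(h) / [d.+1], with chi the character of [psi], and by
    [schur_norm] the products chi(h) chi(h^-1) add up to n; the powers of n cancel. *)
Lemma galg_morph_casimir : Psi casimir = (iota (inv_sqr d))%:M.
Proof.
have n0 : n%:R != 0 :> K by have := card_group_gt0; case: n.
rewrite galg_morphZ rmorph_sum.
under eq_bigr => h _.
  rewrite rmorphM !galg_morph_conj_sum !galg_morphE !galg_map_of.
  rewrite -[_ * _]/(_ *m _) -scalar_mxM.
  rewrite mulrACA [X in X * _]mulrACA -mulrA.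
  over.
rewrite -raddf_sum /= -mulr_sumr -mulr_suml (schur_norm psi_surj char0K).
rewrite scale_scalar_mx; congr (_%:M); rewrite /inv_sqr !fmorphV !rmorphXn !rmorph_nat.
by rewrite -invfM -expr2 [X in _ * X]mulrA -expr2 -exprSr mulKf // expf_neq0.
Qed.

(** By [surj_morph_dim_lt] the degree of [psi] is among the nodes, where a Lagrange polynomial takes
    the values 0 and 1. *)
Lemma galg_morph_degree_idem i : Psi (degree_idem i) = (i == d :> nat)%:R.
Proof.
transitivity ((iota ((lagrange_poly i).[inv_sqr d]))%:M : 'M[K]_d.+1).
  rewrite horner_coef !rmorph_sum; apply: eq_bigr => j _.
  rewrite galg_morphZ [Psi (_ ^+ _)]rmorphXn galg_morph_casimir.
  rewrite -(rmorphXn (@scalar_mx K d.+1)) scale_scalar_mx -rmorphXn -rmorphM //.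
rewrite (lagrange_sample card_group_gt0 inv_sqr_inj i
  (Ordinal (surj_morph_dim_lt psi_surj))).
by rewrite !rmorph_nat.
Qed.

Lemma galg_morph_degree_elt : Psi degree_elt = d.+1%:R.
Proof.
rewrite rmorph_sum (bigD1 (Ordinal (surj_morph_dim_lt psi_surj))) // big1 => [|i ni].
  by rewrite galg_morphZ galg_morph_degree_idem eqxx rmorph_nat /= addr0 scaler_nat.
rewrite galg_morphZ galg_morph_degree_idem; case: eqP => [e|_]; last by rewrite scaler0.
by case/eqP: ni; apply: val_inj.
Qed.

Lemma galg_morph_red_trace x : Psi (red_trace x) = (\tr (Psi x))%:M.
Proof.
rewrite galg_morphZ rmorphM galg_morph_degree_elt galg_morph_conj_sum fmorphV rmorph_nat.
have E (y : K) : y / d.+1%:R *+ d.+1 = y by rewrite -[LHS]mulr_natr divfK.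
rewrite mulr_natl -raddfMn /= scale_scalar_mx E.
by rewrite mulKf //; have := card_group_gt0; case: n.
Qed.

Lemma Nrd_newtonP b (M : 'M[A]_b) :
  Psi (Nrd_newton M) = (\det (block_morph Psi (hom_mx M)))%:M.
Proof.
rewrite rmorph_sum (bigD1 (Ordinal (surj_morph_dim_lt psi_surj))) //.
rewrite big1 => [|i ni]; last first.
  rewrite rmorphM galg_morph_degree_idem; case: eqP => [e|_]; last by rewrite mul0r.
  by case/eqP: ni; apply: val_inj.
rewrite rmorphM galg_morph_degree_idem eqxx mul1r rmorphM rmorphXn rmorphN1 [LHS]addr0.
have sz : (b * d.+1 = \sum_(j < b) d.+1)%N by rewrite sum_nat_const card_ord.
pose t k := \tr (block_morph Psi (hom_mx M) ^+ k).
(* On scalar matrices the Newton expression is that of the traces over [K], to which [det_newton]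
   applies with size [b * d.+1]. *)
rewrite (newton_morph _ _ (c' := fun k => scalar_mx (k%:R^-1))
  (t' := fun k => scalar_mx (t k))); last 2 first.
- by move=> k; rewrite galg_morphZ rmorph1 fmorphV rmorph_nat scalemx1.
- by move=> k; rewrite galg_morph_red_trace /t -block_morphX mxtrace_block_morph.
rewrite -(newton_morph (f := @scalar_mx K d.+1) _ _ (c := fun k => k%:R^-1) (t := t)) //.
rewrite (@det_newton _ _ _ (fun k => newton (fun k => k%:R^-1) t k k)) //.
  by rewrite -sz rmorphM rmorphXn rmorphN1.
move=> k; rewrite newton_rec mulNrn -mulrnAl; congr (- _).
have -> : k.+1%:R^-1 *+ k.+1 = 1 :> K by rewrite -[LHS]mulr_natr mulVf.
by rewrite mul1r.
Qed.

End Morph.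

Lemma Nrd_exists b (M : 'M[A]_b) : is_Nrd_all M (Nrd_newton M).
Proof.
split=> [|K iota d psi psi_surj]; last exact: Nrd_newtonP.
apply: ring_center_sum => i _; apply: ring_centerM; first exact: degree_idem_center.
apply: ring_centerM.
  by move=> x; rewrite -signr_odd; case: odd; rewrite ?mulN1r ?mulrN1 ?mul1r ?mulr1.
apply: newton_center => k; apply: ring_centerZ; first exact: ring_center1.
apply: ring_centerM; last exact: conj_sum_center.
by apply: ring_center_sum => j _; apply/ring_centerZ/degree_idem_center.
Qed.

End NrdExists.

(** * Splitting fields *)

Section RepAlgebra.
Variables (K : fieldType) (gT : finGroupType) (d : nat).
Variable rG : mx_representation K [set: gT]%G d.+1.

Definition rep_alg (x : galg K gT) : 'M[K]_d.+1 := \sum_g x g *: rG g.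

Fact rep_alg_is_zmod : zmod_morphism rep_alg.
Proof.
move=> x y; rewrite /rep_alg -sumrB; apply: eq_bigr => g _.
by rewrite !ffunE scalerBl.
Qed.
Fact rep_alg_is_scalable : scalable rep_alg.
Proof.
move=> a x; rewrite /rep_alg scaler_sumr; apply: eq_bigr => g _.
by rewrite !ffunE scalerA.
Qed.
HB.instance Definition _ := GRing.isZmodMorphism.Build _ _ rep_alg rep_alg_is_zmod.
HB.instance Definition _ := GRing.isScalable.Build _ _ _ _ rep_alg rep_alg_is_scalable.

Lemma rep_alg_of g : rep_alg (galg_of K g) = rG g.
Proof.
rewrite /rep_alg (bigD1 g) //= big1 ?addr0 => [|h /negPf hg].
  by rewrite ffunE eqxx scale1r.
by rewrite ffunE hg scale0r.
Qed.

Fact rep_alg_is_monoid : monoid_morphism rep_alg.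
Proof.
split=> [|x y]; first by rewrite -galg_of1 rep_alg_of repr_mx1.
rewrite (galg_sumE x) !raddf_sum big_distrl /= raddf_sum big_distrl; apply: eq_bigr => g _.
rewrite /= -scalerAl !linearZ /= -scalerAl rep_alg_of; congr (_ *: _).
rewrite (galg_sumE y) big_distrr /= !raddf_sum big_distrr; apply: eq_bigr => h _.
by rewrite /= -scalerAr !linearZ /= -scalerAr -galg_ofM !rep_alg_of repr_mxM ?inE.
Qed.
HB.instance Definition _ := GRing.isMonoidMorphism.Build _ _ rep_alg rep_alg_is_monoid.

End RepAlgebra.

(** Absolute irreducibility makes the enveloping algebra the full matrix algebra. The kernel is
    expressed through [rG] because its degree [n] is only shown by case analysis to be a
    successor. *)
Lemma abs_irr_morph (K : fieldType) (gT : finGroupType) n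
    (rG : mx_representation K [set: gT]%G n) : mx_absolutely_irreducible rG ->
  exists d (psi : {lrmorphism galg K gT -> 'M[K]_d.+1}),
    (forall x, psi x = 0 <-> \sum_g x g *: rG g = 0) /\ (forall y, exists x, psi x = y).
Proof.
case: n rG => [|d] rG /mx_abs_irrP[// _ [a aP]].
exists d, (rep_alg rG); split=> // y; exists [ffun g => a g y].
rewrite [RHS]aP; apply: eq_big => [g|g _]; first by rewrite inE.
by rewrite ffunE.
Qed.

(** Maschke and Wedderburn for the regular representation over a splitting field of the group: the
    components are the irreducible representations in its socle. *)
Lemma splitting_exists (F : fieldType) (gT : finGroupType) :
  (forall k, k.+1%:R != 0 :> F) ->
  exists (K : fieldType) (iota : {rmorphism F -> K}) (s : nat) (d : 'I_s -> nat)
    (phi : forall i, {lrmorphism galg K gT -> 'M[K]_((d i).+1)}), is_splitting phi.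
Proof.
(* Splitting fields and socles exist only [classically], that is for boolean goals. *)
move=> char0; apply/asboolP.
have := @group_splitting_field_exists gT [set: gT]%G F; apply=> -[K iota splitK].
have char0K k : k.+1%:R != 0 :> K by rewrite -(rmorph_nat iota) fmorph_eq0.
pose G := [set: gT]%G; pose aG := regular_repr K G.
have := socle_exists aG; apply=> sG; apply/asboolP.
have K'G : ([pchar K]^'.-group G)%g.
  apply/pgroupP => q q_pr _; rewrite inE /= inE /= q_pr /=.
  by case: q q_pr => // q _.
pose S (i : sG) (x : galg K gT) := \sum_g x g *: irr_repr (sG := sG) i g.
have [d dP] := choice (fun i : sG => abs_irr_morph (splitK _ _ (socle_irr i))).
have [phi phiP] : exists phi : forall i, {lrmorphism galg K gT -> 'M[K]_((d i).+1)},
    forall i, (forall x, phi i x = 0 <-> S i x = 0) /\ (forall y, exists x, phi i x = y).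
  exists (fun i => projT1 (cid (dP i))) => i; exact: (projT2 (cid (dP i))).
pose toR (x : galg K gT) := \sum_g x g *: aG g.
have opS i x : gring_op (irr_repr (sG := sG) i) (toR x) = S i x.
  rewrite linear_sum; apply: eq_bigr => g _; rewrite linearZ /=.
  by rewrite gring_opG ?inE.
have toR_mem x : (toR x \in group_ring K G)%MS.
  rewrite linear_sum; apply: summx_sub => g _.
  by rewrite linearZ scalemx_sub // envelop_mx_id ?inE.
(* Preimages of the Wedderburn idempotents; they act as 1 on their own component and as 0 on the
   others. *)
have /choice[e eE] : forall i : sG, exists x, toR x = Wedderburn_id i.
  move=> i.
  have /envelop_mxP[a aE] : (Wedderburn_id i \in group_ring K G)%MS.
    by rewrite -(Wedderburn_sum_pchar sG K'G) (sumsmx_sup i) ?Wedderburn_id_mem.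
  exists [ffun g => a g]; rewrite aE; apply: eq_big => [g|g _]; first by rewrite inE.
  by rewrite ffunE.
have S_id i j : phi i (e j) = (i == j)%:R.
  have [<-|ij] := eqVneq.
    apply/eqP; rewrite -subr_eq0 -(rmorph1 (phi i)) -rmorphB; apply/eqP.
    apply/(proj1 (phiP i)); rewrite -opS.
    have -> : toR (e i - 1) = toR (e i) - toR 1.
      rewrite /toR -sumrB; apply: eq_bigr => g _; by rewrite !ffunE scalerBl.
    have -> : toR 1 = 1%:M.
      rewrite /toR (bigD1 1%g) //= big1 ?addr0 => [|h /negPf hg].
        by rewrite ffunE eqxx scale1r repr_mx1.
      by rewrite ffunE hg scale0r.
    by rewrite linearB /= gring_op1 eE op_Wedderburn_id_pchar ?subrr.
  apply/(proj1 (phiP i)); rewrite -opS eE.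
  by rewrite (irr_repr'_op0_pchar K'G _ (Wedderburn_id_mem j)) // eq_sym.
exists K, iota, #|{: sG}|, (fun k => d (enum_val k)), (fun k => phi (enum_val k)).
split=> [x x0|y].
  have {}x0 i : S i x = 0 by apply/(proj1 (phiP i)); rewrite -(enum_rankK i).
  suff X0 : toR x = 0.
    apply/ffunP => g; rewrite ffunE.
    have := congr1 (fun Y => gring_proj g Y 0 0) X0.
    rewrite linear_sum summxE (bigD1 g) //= big1 ?addr0 => [|h hg].
      rewrite linearZ /= gring_projE ?inE // mxE eqxx mxE mulr1 => ->.
      by rewrite linear0 mxE.
    by rewrite linearZ /= gring_projE ?inE // mxE eq_sym (negPf hg) mxE mulr0.
  (* The Wedderburn components of [toR x] vanish one by one: an irreducible representation is
     injective on its own component. *)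
  rewrite -[toR x]mul1mx -(Wedderburn_sum_id_pchar sG K'G) mulmx_suml big1 // => i _.
  have Ri : (Wedderburn_id i *m toR x \in Wedderburn_subring i)%MS.
    case/andP: (Wedderburn_ideal i) => _; apply: submx_trans.
    by rewrite mem_mulsmx ?Wedderburn_id_mem.
  have := @regular_op_inj_pchar K gT G sG K'G _ (irr_repr i) (socle_irr i).
  move=> /(_ (Wedderburn_id i *m toR x) 0); apply.
  - by rewrite inE irr_reprK_pchar.
  - by rewrite inE linear0 sub0mx.
  - by rewrite gring_opM // opS x0 mulmx0 linear0.
have [x xP] := choice (fun k => proj2 (phiP (enum_val k)) (y k)).
(* Preimages for the separate components are combined by the orthogonal idempotents. *)
exists (\sum_k x k * e (enum_val k)) => i.
rewrite rmorph_sum (bigD1 i) //= big1 ?addr0 => [|j ji].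
  by rewrite rmorphM /= S_id eqxx mulr1 xP.
by rewrite rmorphM /= S_id (inj_eq enum_val_inj) eq_sym (negPf ji) mulr0.
Qed.

(** * Properties of reduced norms *)

(** [galg_push] carrying the proof that [f] is multiplicative, so that the ring morphism structure
    can be attached to it. *)
Definition galg_push_hom (R : comNzRingType) (gT hT : finGroupType) (f : gT -> hT)
  of {morph f : x y / (x * y)%g} := @galg_push R gT hT f.

Section GalgPushHom.
Variables (R : comNzRingType) (gT hT : finGroupType) (f : gT -> hT).
Hypothesis fM : {morph f : x y / (x * y)%g}.
Local Notation push := (@galg_push_hom R _ _ _ fM).

Fact galg_push_is_scalable : scalable push.
Proof.
move=> a x; apply/ffunP => h; rewrite !ffunE big_distrr /=.
by apply: eq_bigr => g _; rewrite ffunE.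
Qed.
Fact galg_push_is_monoid : monoid_morphism push.
Proof.
split=> [|x y]; last exact: galg_pushM.
rewrite /galg_push_hom -galg_of1 galg_push_of -galg_of1; congr galg_of.
by apply: (mulgI (f 1%g)); rewrite -fM !mulg1.
Qed.
HB.instance Definition _ := GRing.isZmodMorphism.Build _ _ push (galg_pushB f).
HB.instance Definition _ := GRing.isScalable.Build _ _ _ _ push galg_push_is_scalable.
HB.instance Definition _ := GRing.isMonoidMorphism.Build _ _ push galg_push_is_monoid.

Lemma galg_push_surj (y : galg R hT) : (forall h, exists g, f g = h) ->
  exists x : galg R gT, galg_push f x = y.
Proof.
move=> /choice[s fs]; exists (\sum_h y h *: galg_of R (s h)).
rewrite -[LHS]/(push _) raddf_sum [RHS]galg_sumE; apply: eq_bigr => h _ /=.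
by rewrite linearZ /= /galg_push_hom galg_push_of fs.
Qed.
End GalgPushHom.

Lemma galg_push_map (R S : comNzRingType) (gT hT : finGroupType) (f : gT -> hT)
  (iota : {rmorphism R -> S}) (x : galg R gT) :
  galg_map iota (galg_push f x) = galg_push f (galg_map iota x).
Proof.
apply/ffunP => h; rewrite !ffunE rmorph_sum.
by apply: eq_bigr => g _; rewrite ffunE.
Qed.

Section NrdTheory.
Variables (F : fieldType).
Hypothesis char0 : forall k, k.+1%:R != 0 :> F.

(** Components of splittings are surjective, so [is_Nrd_all] implies [is_Nrd], and a single
    splitting shows that [is_Nrd] has at most one solution. *)
Lemma Nrd_unique (gT : finGroupType) b (M : 'M[galg F gT]_b) z :
  is_Nrd_all M z -> Nrd M = z.
Proof.
have weak z' : is_Nrd_all M z' -> is_Nrd M z'.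
  move=> [zC zP]; split=> // K iota s d phi phi_split i.
  apply: (zP K iota _ (phi i)) => y.
  (* The family with [y] at [i], transported along the equality of indices, and 0 elsewhere. *)
  pose Y j := match eqVneq j i with
    | EqNotNeq e => eq_rect i (fun j => 'M[K]_((d j).+1)) y j (esym e)
    | NeqNotEq _ => 0 end.
  have [x xP] := proj2 phi_split Y; exists x; rewrite xP /Y.
  by case: eqVneq => [e|]; rewrite ?eqxx // (eq_irrelevance (esym e) (erefl i)).
have [K [iota [s [d [phi phi_split]]]]] := splitting_exists gT char0.
have uniq z1 z2 : is_Nrd M z1 -> is_Nrd M z2 -> z1 = z2.
  move=> [_ P1] [_ P2].
  have : galg_map iota z1 - galg_map iota z2 = 0.
    apply: (proj1 phi_split) => i; rewrite rmorphB /=.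
    by rewrite (P1 _ _ _ _ _ phi_split) (P2 _ _ _ _ _ phi_split) subrr.
  move/eqP; rewrite subr_eq0 => /eqP/ffunP E; apply/ffunP => g.
  by have := E g; rewrite !ffunE => /fmorph_inj.
move=> /weak zP; apply: uniq zP; apply: (xgetPex 0); exists (Nrd_newton M).
exact/weak/Nrd_exists.
Qed.

Lemma NrdP (gT : finGroupType) b (M : 'M[galg F gT]_b) : is_Nrd_all M (Nrd M).
Proof. by rewrite (Nrd_unique (Nrd_exists char0 M)); apply: Nrd_exists. Qed.

Variable gT : finGroupType.
Local Notation A := (galg F gT).

Lemma Nrd_center b (M : 'M[A]_b) : ring_center (Nrd M).
Proof. by have [] := NrdP M. Qed.

(** The transposes cancel those of [hom_mx]; over a noncommutative ring [(B *m C)^T] need not be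
    [C^T *m B^T]. *)
Lemma Nrd_mulmx b (B C : 'M[A]_b) : Nrd (B *m C)^T = Nrd B^T * Nrd C^T.
Proof.
apply: Nrd_unique; split=> [|K iota d psi psi_surj].
  by apply: ring_centerM; apply: Nrd_center.
rewrite rmorphM !(proj2 (NrdP _)) // /hom_mx !trmxK block_morphM det_mulmx.
by rewrite -[_ * _]/(_ *m _) -scalar_mxM.
Qed.

Lemma Nrd_ltrig b b' (B : 'M[A]_b) D (C : 'M[A]_b') :
  Nrd (block_mx B 0 D C)^T = Nrd B^T * Nrd C^T.
Proof.
apply: Nrd_unique; split=> [|K iota d psi psi_surj].
  by apply: ring_centerM; apply: Nrd_center.
rewrite rmorphM !(proj2 (NrdP _)) // /hom_mx !trmxK det_block_morph_ltrig.
by rewrite -[_ * _]/(_ *m _) -scalar_mxM.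
Qed.

Lemma Nrd_utrig b b' (B : 'M[A]_b) D (C : 'M[A]_b') :
  Nrd (block_mx B D 0 C)^T = Nrd B^T * Nrd C^T.
Proof.
apply: Nrd_unique; split=> [|K iota d psi psi_surj].
  by apply: ring_centerM; apply: Nrd_center.
rewrite rmorphM !(proj2 (NrdP _)) // /hom_mx !trmxK det_block_morph_utrig.
by rewrite -[_ * _]/(_ *m _) -scalar_mxM.
Qed.

Lemma Nrd1 b : Nrd (1%:M : 'M[A]_b) = 1.
Proof.
apply: Nrd_unique; split=> [|K iota d psi psi_surj]; first exact: ring_center1.
by rewrite rmorph1 /hom_mx trmx1 block_morph1 det1.
Qed.

(** A surjection of [galg K hT] onto a matrix algebra, composed with the push along [f], is one of
    [galg K gT], so the property of [Nrd M] can be tested on it. *)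
Lemma Nrd_push (hT : finGroupType) (f : gT -> hT) b (M : 'M[A]_b) :
  {morph f : x y / (x * y)%g} -> (forall h, exists g, f g = h) ->
  galg_push f (Nrd M) = Nrd (map_mx (galg_push f) M).
Proof.
move=> fM f_surj; apply/esym/Nrd_unique; split=> [|K iota d psi psi_surj].
  move=> y; have [x <-] := galg_push_surj fM y f_surj.
  by rewrite -!galg_pushM // (Nrd_center M x).
pose psi' : {lrmorphism galg K gT -> 'M[K]_d.+1} := (psi \o galg_push_hom fM).
have psi'_surj y : exists x, psi' x = y.
  have [x' <-] := psi_surj y; have [x <-] := galg_push_surj fM x' f_surj.
  by exists x.
rewrite galg_morphE galg_push_map -[LHS]/(galg_morph iota psi' (Nrd M)).
rewrite (proj2 (NrdP M)) //; congr (_%:M); congr determinant.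
apply: eq_mxblock => i j; rewrite !galg_morphE /hom_mx !mxE.
by rewrite galg_push_map.
Qed.

End NrdTheory.

(** * Characteristic zero of the p-adic numbers *)

Section PadicChar0.
Variables (p : nat) (p_pr : prime p).

Lemma padicZ_natE k n : (k%:R : padicZ p_pr) n = (k %% p ^ n)%N.
Proof.
elim: k => [|k IH] //; rewrite mulrS -addn1 addnC.
rewrite -[LHS]/(((1 %% p ^ n) + (k%:R : padicZ p_pr) n) %% p ^ n)%N IH.
by rewrite modnDm.
Qed.

Lemma padicZ_char0 k : k.+1%:R != 0 :> padicZ p_pr.
Proof.
apply/eqP => /(congr1 (fun x : padicZ p_pr => x k.+1)).
(* Level [k.+1] detects [k.+1] because [k.+1 < p ^ k.+1]. *)
rewrite padicZ_natE modn_small; last exact: ltn_expl (prime_gt1 p_pr).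
by rewrite -[RHS]/(0 %% _)%N mod0n.
Qed.

Lemma padicQ_char0 k : k.+1%:R != 0 :> padicQ p_pr.
Proof. by rewrite -(rmorph_nat (@tofrac (padicZ p_pr))) tofrac_eq0 padicZ_char0. Qed.

End PadicChar0.

(** * Fitting invariants of modules with a square presentation *)

Section ModuleSpan.
Variables (R : pzRingType) (C A : set R).

Lemma module_span0 : module_span C A 0.
Proof.
by exists 0%N, (fun=> 0), (fun=> 0); split=> [[]|[]|] //; rewrite big_ord0.
Qed.

Lemma module_spanZ c y : C c -> A y -> module_span C A (c * y).
Proof.
by move=> Cc Ay; exists 1%N, (fun=> c), (fun=> y); split=> //; rewrite big_ord1.
Qed.

Lemma module_spanD x y :
  module_span C A x -> module_span C A y -> module_span C A (x + y).
Proof.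
move=> [k [c [u [Cc Au ->]]]] [k' [c' [u' [Cc' Au' ->]]]].
pose g T (a : 'I_k -> T) (a' : 'I_k' -> T) i :=
  match split i with inl j => a j | inr j => a' j end.
exists (k + k')%N, (g _ c c'), (g _ u u'); split.
- by move=> i; rewrite /g; case: (split i).
- by move=> i; rewrite /g; case: (split i).
rewrite big_split_ord; congr (_ + _); apply: eq_bigr => i _ /=; rewrite /g.
  by rewrite (unsplitK (inl i)).
by rewrite (unsplitK (inr i)).
Qed.

Lemma module_span_sum I (r : seq I) (P : pred I) (F : I -> R) :
  (forall i, P i -> module_span C A (F i)) ->
  module_span C A (\sum_(i <- r | P i) F i).
Proof.
by move=> FP; elim/big_ind: _ => //; [exact: module_span0|exact: module_spanD].
Qed.

(** The generators are central, so they move past the coefficients. *)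
Lemma module_spanM x y :
  (forall c c', C c -> C c' -> C (c * c')) ->
  (forall u u', A u -> A u' -> A (u * u')) ->
  (forall u, A u -> ring_center u) ->
  module_span C A x -> module_span C A y -> module_span C A (x * y).
Proof.
move=> CM AM AC [k [c [u [Cc Au ->]]]] [k' [c' [u' [Cc' Au' ->]]]].
rewrite mulr_suml; apply: module_span_sum => i _ /=.
rewrite mulr_sumr; apply: module_span_sum => j _ /=.
by rewrite -mulrA (mulrA (u i)) (AC (u i)) // -mulrA mulrA; apply: module_spanZ; auto.
Qed.

End ModuleSpan.

(** * The ring I(Lambda) and reduced norms over Lambda *)

Section IntegralityRing.
Variables (p : nat) (p_pr : prime p) (l : nat) (G : profiniteGroupType).
Variable hG : is_uniform p l G.
Local Notation L := (Lambda p_pr G).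
Local Notation char0 := (padicQ_char0 p_pr).

Fact to_padicQ_is_zmod gT : zmod_morphism (@to_padicQ p p_pr gT).
Proof. exact: galg_map_is_additive. Qed.
Fact to_padicQ_is_monoid gT : monoid_morphism (@to_padicQ p p_pr gT).
Proof. exact: galg_map_is_multiplicative. Qed.
HB.instance Definition _ gT :=
  GRing.isZmodMorphism.Build _ _ (@to_padicQ p p_pr gT) (@to_padicQ_is_zmod gT).
HB.instance Definition _ gT :=
  GRing.isMonoidMorphism.Build _ _ (@to_padicQ p p_pr gT) (@to_padicQ_is_monoid gT).

Fact Lambda_proj_is_zmod n : zmod_morphism (@Lambda_proj p p_pr l G hG n).
Proof. by []. Qed.
Fact Lambda_proj_is_monoid n : monoid_morphism (@Lambda_proj p p_pr l G hG n).
Proof. by []. Qed.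
HB.instance Definition _ n :=
  GRing.isZmodMorphism.Build _ _ (@Lambda_proj p p_pr l G hG n) (@Lambda_proj_is_zmod n).
HB.instance Definition _ n :=
  GRing.isMonoidMorphism.Build _ _ (@Lambda_proj p p_pr l G hG n)
    (@Lambda_proj_is_monoid n).

Lemma Gquo_proj_surj n (h : Gquo hG n) : exists g : Gquo hG n.+1, Gquo_proj g = h.
Proof. by exists (cls _ (rep h)); rewrite Gquo_proj_cls repK. Qed.

Lemma I_finM gT x y :
  @I_fin p p_pr gT x -> @I_fin p p_pr gT y -> @I_fin p p_pr gT (x * y).
Proof.
apply: module_spanM.
- move=> _ _ [c cC <-] [c' cC' <-]; exists (c * c'); last by rewrite rmorphM.
  exact: ring_centerM.
- move=> _ _ [b [H [b0 ->]]] [b' [H' [b0' ->]]].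
  (* A product of reduced norms of different sizes is the reduced norm of the block diagonal
     matrix. *)
  exists (b + b')%N, (block_mx H 0 0 H'); split; first by rewrite addn_gt0 b0.
  have := Nrd_ltrig char0 (map_mx (@to_padicQ p p_pr gT) H)^T 0
    (map_mx (@to_padicQ p p_pr gT) H')^T.
  rewrite !trmxK => <-; congr Nrd; rewrite tr_block_mx !trmxK !trmx0 map_block_mx.
  by rewrite !map_mx0.
- by move=> _ [b [H [_ ->]]]; apply: (Nrd_center char0).
Qed.

Local Notation I := (@I_Lambda p p_pr l G hG).

Lemma I_Lambda0 : I 0.
Proof.
move=> n; split; first exact: module_span0.
exact: (raddf0 (galg_push_hom (@Gquo_projM p l G hG n))).
Qed.

Lemma I_LambdaD x y : I x -> I y -> I (x + y).
Proof.
move=> Ix Iy n; have [[Fx Ex] [Fy Ey]] := (Ix n, Iy n); split.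
  exact: module_spanD.
rewrite -[(x + y) n]/(x n + y n) -Ex -Ey.
exact: (raddfD (galg_push_hom (@Gquo_projM p l G hG n))).
Qed.

Lemma I_LambdaM x y : I x -> I y -> I (x * y).
Proof.
move=> Ix Iy n; have [[Fx Ex] [Fy Ey]] := (Ix n, Iy n); split.
  exact: I_finM.
rewrite -[(x * y) n]/(x n * y n) -Ex -Ey.
exact: (rmorphM (galg_push_hom (@Gquo_projM p l G hG n))).
Qed.

Lemma Nrd_Lambda_I b (W : 'M[L]_b) : (0 < b)%N -> I (Nrd_Lambda hG W).
Proof.
move=> b0 n; split.
  rewrite -[Nrd_Lambda hG W n]mul1r; apply: module_spanZ.
    by exists 1; [exact: ring_center1|rewrite rmorph1].
  exists b, (map_mx (Lambda_proj hG n) W); split=> //.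
  by rewrite /Nrd_Lambda -map_mx_comp.
rewrite /Nrd_Lambda (Nrd_push char0); [|exact: Gquo_projM|exact: Gquo_proj_surj].
congr Nrd; rewrite -map_mx_comp; apply: eq_map_mx => x /=.
by rewrite /to_padicQ -galg_push_map Lambda_projP.
Qed.

Lemma Nrd_Lambda_mulmx b (B C : 'M[L]_b) :
  Nrd_Lambda hG (B *m C)^T = Nrd_Lambda hG B^T * Nrd_Lambda hG C^T.
Proof.
apply: functional_extensionality_dep => n.
pose f : {rmorphism L -> _} := @to_padicQ p p_pr _ \o @Lambda_proj p p_pr l G hG n.
rewrite -[LHS]/(Nrd (map_mx f _)) -map_trmx map_mxM (Nrd_mulmx char0).
by rewrite !map_trmx.
Qed.

Lemma Nrd_Lambda_ltrig b b' (B : 'M[L]_b) D (C : 'M[L]_b') :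
  Nrd_Lambda hG (block_mx B 0 D C)^T = Nrd_Lambda hG B^T * Nrd_Lambda hG C^T.
Proof.
apply: functional_extensionality_dep => n.
pose f : {rmorphism L -> _} := @to_padicQ p p_pr _ \o @Lambda_proj p p_pr l G hG n.
rewrite -[LHS]/(Nrd (map_mx f _)) -map_trmx map_block_mx map_mx0 (Nrd_ltrig char0).
by rewrite !map_trmx.
Qed.

Lemma Nrd_Lambda_utrig b b' (B : 'M[L]_b) D (C : 'M[L]_b') :
  Nrd_Lambda hG (block_mx B D 0 C)^T = Nrd_Lambda hG B^T * Nrd_Lambda hG C^T.
Proof.
apply: functional_extensionality_dep => n.
pose f : {rmorphism L -> _} := @to_padicQ p p_pr _ \o @Lambda_proj p p_pr l G hG n.
rewrite -[LHS]/(Nrd (map_mx f _)) -map_trmx map_block_mx map_mx0 (Nrd_utrig char0).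
by rewrite !map_trmx.
Qed.

Lemma Nrd_Lambda1 b : Nrd_Lambda hG (1%:M : 'M[L]_b) = 1.
Proof.
apply: functional_extensionality_dep => n.
pose f : {rmorphism L -> _} := @to_padicQ p p_pr _ \o @Lambda_proj p p_pr l G hG n.
by rewrite -[LHS]/(Nrd (map_mx f _)) map_mx1 (Nrd1 char0).
Qed.

Lemma linear_lift (N : lmodType L) b m (f : {linear 'rV[L]_b -> N})
    (g : {linear 'rV[L]_m -> N}) : (forall z, exists y, g y = z) ->
  exists U : 'M[L]_(b, m), forall y, f y = g (y *m U).
Proof.
move=> g_surj; have /choice[u uP] : forall i, exists y, g y = f (delta_mx 0 i).
  by move=> i; apply: g_surj.
exists (\matrix_i u i) => y.
rewrite [in LHS](row_sum_delta y) mulmx_sum_row !linear_sum; apply: eq_bigr => i _.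
by rewrite !linearZ /= rowK uP.
Qed.

Lemma Fitt_quadratic (N : lmodType L) m (M : 'M[L]_m) : (0 < m)%N ->
  presents N M -> Fitt hG N = principal_I hG (Nrd_Lambda hG M).
Proof.
move=> m0 presM; apply/seteqP; split=> z; last first.
  move=> [c Ic <-]; apply: module_spanZ => //; exists m, m, M, id; split=> //.
  by congr (Nrd_Lambda hG _); apply/matrixP => i j; rewrite mxE.
move=> [k [c [y [Ic yP ->]]]].
suff H i : principal_I hG (Nrd_Lambda hG M) (y i).
  elim/big_ind: _ => [|_ _ [u Iu <-] [v Iv <-]|i _].
  - by exists 0; [exact: I_Lambda0|rewrite mul0r].
  - by exists (u + v); [exact: I_LambdaD|rewrite mulrDl].
  have [u Iu <-] := H i; exists (c i * u); last by rewrite mulrA.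
  exact: I_LambdaM.
have [a [b [H [f [b0 [ph [ph_surj ph_ker]] _ ->]]]]] := yP i.
have [g [g_surj g_ker]] := presM.
pose P := (colsub f H)^T; pose Q := M^T.
(* The rows of [P] are among the relations, namely those selected by [f]. *)
have P0 (x : 'rV_b) : ph (x *m P) = 0.
  apply/ph_ker; exists (x *m rowsub f 1%:M).
  by rewrite -mulmxA mul_rowsub_mx mul1mx /P trmx_mxsub.
have [U UP] := linear_lift ph g_surj; have [V VP] := linear_lift g ph_surj.
(* Rows in the kernel of [g] are combinations of the rows of [Q]. *)
have factor k' (Y : 'M[L]_(k', m)) : (forall x : 'rV_k', g (x *m Y) = 0) ->
    exists W : 'M[L]_(k', m), Y = W *m Q.
  move=> Y0; have /choice[w wP] : forall j, exists x : 'rV[L]_m, row j Y = x *m Q.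
    by move=> j; apply/g_ker; rewrite rowE.
  by exists (\matrix_j w j); apply/row_matrixP => j; rewrite row_mul rowK.
have [W12 E12] : exists W : 'M[L]_(b, m), P *m U = W *m Q.
  by apply: factor => x; rewrite mulmxA -UP.
have [W22 E22] : exists W : 'M[L]_m, 1%:M - V *m U = W *m Q.
  by apply: factor => x; rewrite mulmxBr mulmx1 mulmxA raddfB /= -UP -VP subrr.
(* The rows of [P *m U] are relations since [ph] kills those of [P], and the rows of [1 - V *m U]
   are since [V *m U] lifts the identity. The triangular matrices on the left and on the far right
   have norms [Nrd P] and [Nrd Q]. *)
have E : block_mx P 0 (- V) 1%:M =
    block_mx P W12 (- V) W22 *m block_mx 1%:M (- U) 0 Q.
  rewrite mulmx_block !mulmx1 !mulmx0 !addr0 mulmxN -E12 addNr; congr block_mx.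
  by rewrite mulNmx mulmxN opprK -E22 addrC subrK.
have := congr1 (fun X => Nrd_Lambda hG X^T) E.
rewrite Nrd_Lambda_ltrig Nrd_Lambda_mulmx Nrd_Lambda_utrig !trmx1 !Nrd_Lambda1.
rewrite mul1r mulr1 !trmxK => ->; eexists; last by [].
by apply: Nrd_Lambda_I; rewrite addn_gt0 b0.
Qed.

End IntegralityRing.

(** * Completed group rings and their finite levels *)

Section Ultralimit.
Variables (p : nat) (p_pr : prime p).
Local Notation Z := (padicZ p_pr).
Local Open Scope classical_set_scope.

(** Pigeonhole principle: either the largest value is taken on a set of the ultrafilter, or the
    bound drops by one. *)
Lemma ultrafilter_finite_value (U : set_system nat) (h : nat -> nat) B :
  UltraFilter U -> (forall N, (h N < B)%N) -> exists r, U [set N | h N = r].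
Proof.
move=> uU hB; have : U [set N | (h N < B)%N].
  by apply: filterS filterT => N _; apply: hB.
elim: B {hB} => [|B IH].
  rewrite (_ : [set N | _] = set0); first by move/filter_not_empty.
  by apply/seteqP; split.
move=> UB; have [UE|UE] := in_ultra_setVsetC [set N | h N = B] uU; first by exists B.
apply: IH; apply: filterS (filterI UB UE) => N /= [].
by rewrite ltnS leq_eqVlt => /orP[/eqP|].
Qed.

(* A limit along a non-principal ultrafilter on nat: it replaces the compactness
   of the profinite modules. *)
Lemma ultralimit_exists : exists L : (nat -> Z) -> Z,
  [/\ forall x y, L (fun N => x N + y N) = L x + L y,
      forall a x, L (fun N => a * x N) = a * L x,
      forall a, L (fun=> a) = a &
      forall x y N0, (forall N, (N0 <= N)%N -> x N = y N) -> L x = L y].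
Proof.
(* [U] refines the filter of cofinite sets, so limits ignore finitely many indices. *)
have [U [uU subU]] := ultraFilterLemma (F := \oo%classic) _.
have res x k : exists r, U [set N | (x N : Z) k = r].
  by apply: (ultrafilter_finite_value (B := p ^ k)) => N; apply: padicZ_lt.
have [r rP] := choice (fun xk : (nat -> Z) * nat => res xk.1 xk.2).
have val_unique x k a : U [set N | (x N : Z) k = a] -> r (x, k) = a.
  by move=> Ua; have [N [/= <- ->]] := filter_ex (filterI (rP (x, k)) Ua).
have compat x k : r (x, k) = (r (x, k.+1) %% p ^ k)%N.
  apply: val_unique; apply: filterS (rP (x, k.+1)) => N /= <-.
  exact: residueP.
pose L x := MkPadicZ p_pr (compat x).
have Lunique x (a : Z) : (forall k, U [set N | (x N : Z) k = a k]) -> L x = a.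
  by move=> xa; apply: padicZ_eq => k; apply: val_unique.
exists L; split.
- move=> x y; apply: Lunique => k.
  by apply: filterS (filterI (rP (x, k)) (rP (y, k))) => N /= [-> ->].
- move=> a x; apply: Lunique => k.
  by apply: filterS (rP (x, k)) => N /= ->.
- by move=> a; apply: Lunique => k; apply: filterS filterT.
move=> x y N0 xy; apply: Lunique => k.
have U0 : U [set N | (N0 <= N)%N] by apply: subU; exists N0.
by apply: filterS (filterI U0 (rP (y, k))) => N /= [/xy -> ->].
Qed.

End Ultralimit.

(** * Lambda as a limit over the subgroups G_n *)

Section Levels.
Variables (p : nat) (p_pr : prime p) (l : nat) (G : profiniteGroupType).
Variable hG : is_uniform p l G.
Local Notation L := (Lambda p_pr G).
Local Notation Gn := (Gsub_n hG).
Local Open Scope classical_set_scope.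

(** The complement is a union of open cosets. *)
Lemma open_subgroup_closed (U : open_normal_subgroup G) : closed (ons_set U).
Proof.
rewrite -openC.
have -> : ~` (ons_set U) = \bigcup_(g in ~` (ons_set U)) lcoset_of (ons_set U) g.
  apply/seteqP; split=> x.
    by move=> Ux; exists x => //; exists 1%g; rewrite ?mulg1 //; apply: ons1.
  move=> [g /= Ug [u Uu <-]] Ugu; apply: Ug.
  by rewrite -(mulgK u g); apply: onsM Ugu (onsV Uu).
by apply: bigcup_open => g _; apply/open_lcoset/ons_open.
Qed.

(** If G/U has order p^n, all p^n-th powers lie in U, which is closed. Hence the levels G_n
    determine all of Lambda. *)
Lemma power_subgroup_cofinal (U : open_normal_subgroup G) :
  exists n, ons_set (Gn n) `<=` ons_set U.
Proof.
have [/(_ U)/p_natP[n cardU] _ _] := hG; exists n => x; apply.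
- by have [] := ons_normal U.
- exact: open_subgroup_closed.
move=> _ [y _ <-]; rewrite -cardU.
suff : cls U 1%g = cls U (y ^+ #|{: quo U}|)%g by move/clsP; rewrite invg1 mul1g.
have clsX k : cls U (y ^+ k)%g = (cls U y ^+ k)%g.
  by elim: k => [|k IH]; rewrite ?expg0 // !expgS clsM IH.
by rewrite clsX -cardsT expg_cardG ?inE.
Qed.

Lemma Gsub_mono n k : ons_set (Gn (k + n)) `<=` ons_set (Gn n).
Proof. by elim: k => // k IH x; rewrite addSn => /Gsub_sub /IH. Qed.

Lemma galg_push_comp (R : comNzRingType) (gT hT kT : finGroupType) (f : gT -> hT)
    (g : hT -> kT) (x : galg R gT) : galg_push g (galg_push f x) = galg_push (g \o f) x.
Proof.
apply/ffunP => k; rewrite !ffunE (partition_big f (fun h => g h == k)) //=.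
apply: eq_bigr => h /eqP gh; rewrite ffunE; apply: eq_bigl => u.
by case: eqP => [->|]; rewrite ?andbF // gh eqxx.
Qed.

Lemma eq_galg_push (R : comNzRingType) (gT hT : finGroupType) (f g : gT -> hT)
    (x : galg R gT) : f =1 g -> galg_push f x = galg_push g x.
Proof. by move=> fg; apply/ffunP => h; rewrite !ffunE; apply: eq_bigl => u; rewrite fg. Qed.

Lemma galg_push_id (R : comNzRingType) (gT : finGroupType) (f : gT -> gT)
    (x : galg R gT) : f =1 id -> galg_push f x = x.
Proof.
by move=> fE; apply/ffunP => h; rewrite ffunE (big_pred1 h) // => u; rewrite /= fE.
Qed.

Lemma quo_proj_comp (U V W : open_normal_subgroup G) (c : quo U) :
  ons_set U `<=` ons_set V -> ons_set V `<=` ons_set W ->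
  quo_proj W (quo_proj V c) = quo_proj W c.
Proof.
by move=> UV VW; rewrite -(repK c) !quo_projE //; apply: subset_trans VW.
Qed.

Lemma galg_push_quo (U V W : open_normal_subgroup G) (x : galg (padicZ p_pr) (quo U)) :
  ons_set U `<=` ons_set V -> ons_set V `<=` ons_set W ->
  galg_push (@quo_proj G V W) (galg_push (@quo_proj G U V) x) =
  galg_push (@quo_proj G U W) x.
Proof.
by move=> UV VW; rewrite galg_push_comp; apply: eq_galg_push => c; apply: quo_proj_comp.
Qed.

Lemma Lambda_proj_mono (a : L) n k :
  galg_push (@quo_proj G (Gn (k + n)) (Gn n)) (Lambda_proj hG (k + n) a) =
  Lambda_proj hG n a.
Proof. by have /asboolP := Lambda_valP a; apply; apply: Gsub_mono. Qed.

Lemma Lambda_proj_inj (a b : L) :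
  (forall n, Lambda_proj hG n a = Lambda_proj hG n b) -> a = b.
Proof.
move=> ab; apply: val_inj; apply: functional_extensionality_dep => U.
have [n nU] := power_subgroup_cofinal U.
have /asboolP/(_ _ _ nU) aU := Lambda_valP a.
have /asboolP/(_ _ _ nU) bU := Lambda_valP b.
by rewrite -[LHS]aU -[RHS]bU; have := ab n; rewrite /Lambda_proj => ->.
Qed.

(** The component at an arbitrary open normal [U] is pushed down from some level G_n contained in
    [U]. *)
Lemma Lambda_lift (z : forall n, galg (padicZ p_pr) (Gquo hG n)) :
  (forall n, galg_push (@Gquo_proj p l G hG n) (z n.+1) = z n) ->
  exists a : L, forall n, Lambda_proj hG n a = z n.
Proof.
move=> zP.
have zmono n k : galg_push (@quo_proj G (Gn (k + n)) (Gn n)) (z (k + n)%N) = z n.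
  elim: k => [|k IH].
    by rewrite galg_push_id // => c; rewrite /quo_proj repK.
  rewrite -[RHS]IH -(zP (k + n)%N) galg_push_quo //.
    exact: Gsub_sub.
  exact: Gsub_mono.
have [k kP] := choice power_subgroup_cofinal.
pose x U : galg (padicZ p_pr) (quo U) := galg_push (@quo_proj G (Gn (k U)) U) (z (k U)).
(* Independence of the chosen level: the levels [n] and [k U] are both compared with level
   [n + k U]. *)
have xE U n : ons_set (Gn n) `<=` ons_set U ->
    galg_push (@quo_proj G (Gn n) U) (z n) = x U.
  move=> nU; rewrite /x -(zmono n (k U)) -(zmono (k U) n).
  rewrite !galg_push_quo //; try exact: Gsub_mono.
  by rewrite addnC.
have xP : (x : Defs.dprod (fun U => galg (padicZ p_pr) (quo U))) \in
    @Lambda_compat p p_pr G.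
  apply/asboolP => U V UV; rewrite galg_push_quo // xE //.
  by apply: subset_trans UV.
exists (MkLambda xP) => n; rewrite /Lambda_proj /= -(xE (Gn n) n) //.
by rewrite galg_push_id // => c; rewrite /quo_proj repK.
Qed.

End Levels.

(** * The presentation of Pic_infty *)

Section RowDiv.
Variables (p : nat) (p_pr : prime p) (m : nat) (gT : finGroupType).
Local Notation A := (galg (padicZ p_pr) gT).
Local Notation D := (Div ('I_m * gT)%type p_pr).

Definition row_Div (y : 'rV[A]_m) : D := [ffun vg => y 0 vg.1 vg.2].

Lemma row_DivD y z : row_Div (y + z) = row_Div y + row_Div z.
Proof. by apply/ffunP => -[v g]; rewrite !ffunE /= mxE ffunE. Qed.

Lemma row_Div_act a y : row_Div (a *: y) = Div_act a (row_Div y).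
Proof.
apply/ffunP => -[v g]; rewrite !ffunE /= mxE ffunE.
by apply: eq_bigr => h _; rewrite !ffunE.
Qed.

Lemma row_Div0 : row_Div 0 = 0.
Proof. by apply/ffunP => -[v g]; rewrite !ffunE /= mxE ffunE. Qed.

Lemma row_Div_sum I (r : seq I) (P : pred I) F :
  row_Div (\sum_(i <- r | P i) F i) = \sum_(i <- r | P i) row_Div (F i).
Proof. exact: (big_morph _ row_DivD row_Div0). Qed.

Lemma row_Div_inj : injective row_Div.
Proof.
move=> y z /ffunP yz; apply/rowP => v; apply/ffunP => g.
by have := yz (v, g); rewrite !ffunE.
Qed.

Lemma row_Div_surj (x : D) : exists y, row_Div y = x.
Proof.
exists (\row_v [ffun g => x (v, g)]); apply/ffunP => -[v g].
by rewrite !ffunE /= mxE ffunE.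
Qed.

End RowDiv.

Lemma row_Div_push (p : nat) (p_pr : prime p) (m : nat) (gT hT : finGroupType)
    (f : gT -> hT) (y : 'rV[galg (padicZ p_pr) gT]_m) :
  Div_push (fun vg : 'I_m * gT => (vg.1, f vg.2)) (row_Div y) =
  row_Div (map_mx (galg_push f) y).
Proof.
apply/ffunP => -[v h]; rewrite !ffunE /= mxE ffunE.
rewrite (reindex_onto (fun g => (v, g)) snd) /=; last first.
  by move=> [w g]; rewrite /= xpair_eqE => /andP[/eqP -> _].
by apply: eq_big => [g|g _]; rewrite ?xpair_eqE ?eqxx ?andbT // ffunE.
Qed.

Lemma galg_natE (R : comNzRingType) (gT : finGroupType) k (g : gT) :
  (k%:R : galg R gT) g = (g == 1%g)%:R *+ k.
Proof. by elim: k => [|k IH]; rewrite ?mulr0n ?mulrS ffunE // IH ffunE. Qed.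

Section Presentation.
Variables (p : nat) (p_pr : prime p) (l : nat) (G : profiniteGroupType).
Variable hG : is_uniform p l G.
Variables (m : nat) (S : finType) (X : graph 'I_m S) (alpha : S -> G).
Local Notation L := (Lambda p_pr G).
Local Notation Zp := (padicZ p_pr).
Local Notation pr n := (Lambda_proj hG n : L -> _).
Local Notation Xn := (voltage_cover hG X alpha).
Local Notation Pinf := (Pic_infty p_pr hG X alpha).

Definition laplacian : 'M[L]_m := degree_mx p_pr G X - (voltage_mx p_pr X alpha)^T.

(** Row [v] of D - A: an edge leaving [v] contributes its voltage, an edge entering [v] the inverse
    voltage, and [degree] counts both; a loop occurs in both sums. *)
Lemma row_Div_laplacian n v :
  row_Div (row v (map_mx (pr n) (hom_mx laplacian))) = delta (Xn n) p_pr (v, 1%g).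
Proof.
set beta := fun e => cls (Gsub_n hG n) (alpha e) : Gquo hG n.
have Q_E j : map_mx (pr n) (hom_mx laplacian) v j = (degree X j)%:R *+ (j == v) -
    (\sum_(e | (source X e == v) && (target X e == j)) galg_of Zp (beta e) +
     \sum_(e | (source X e == j) && (target X e == v)) galg_of Zp (beta e)^-1%g).
  rewrite /hom_mx /laplacian !mxE.
  rewrite rmorphB rmorphMn rmorph_nat; congr (_ - _); rewrite rmorphD !rmorph_sum /=.
  congr (_ + _); apply: eq_bigr => e _.
  rewrite /beta -[(cls _ _)^-1%g]/(quo_inv _) quo_invE //.
rewrite [RHS]delta_derived; apply/ffunP => -[j g].
rewrite [LHS]ffunE /= [row v _ _ _]mxE Q_E !ffunE !sum_ffunE.
have cE (P : pred S) (c : Zp) : \sum_(e | P e) c = c *+ #|[set e | P e]%SET|.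
  by rewrite -sumr_const; apply: eq_bigl => e; rewrite inE.
under [X in _ = X + _]eq_bigr => e _ do rewrite !ffunE mul1g.
under [X in _ = _ + X]eq_bigr => e _ do rewrite !ffunE mul1g.
rewrite !sumrB addrACA -opprD !cE -mulrnDr; congr (_ - (_ + _)).
- rewrite -/(degree X v) xpair_eqE; have [->|jv] := eqVneq j v.
    by rewrite mulr1n galg_natE.
  by rewrite mulr0n ffunE mul0rn.
- rewrite big_mkcondr; apply: eq_bigr => e _.
  by rewrite ffunE xpair_eqE [_ == j]eq_sym; case: (j == _).
under eq_bigl => e do rewrite andbC.
rewrite big_mkcondr; apply: eq_bigr => e _.
by rewrite ffunE xpair_eqE [_ == j]eq_sym; case: (j == _).
Qed.

Lemma row_Div_mul_laplacian n (x : 'rV[galg Zp (Gquo hG n)]_m) :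
  row_Div (x *m map_mx (pr n) (hom_mx laplacian)) =
  \sum_vg x 0 vg.1 vg.2 *: delta (Xn n) p_pr vg.
Proof.
rewrite mulmx_sum_row row_Div_sum.
under eq_bigr => v _ do rewrite row_Div_act row_Div_laplacian Div_act_delta.
rewrite pair_bigA /=; apply: eq_bigr => -[v g] _ /=.
by rewrite mulg1.
Qed.

Lemma row_Div_Pr n (y : 'rV[galg Zp (Gquo hG n)]_m) :
  row_Div y \in Pr (Xn n) p_pr <->
  exists x, y = x *m map_mx (pr n) (hom_mx laplacian).
Proof.
split=> [/asboolP[c yc]|[x ->]].
  exists (\row_v [ffun g => c (v, g)]); apply: row_Div_inj.
  rewrite row_Div_mul_laplacian yc; apply: eq_bigr => -[v g] _ /=.
  by rewrite mxE ffunE.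
by apply/asboolP; exists (fun vg => x 0 vg.1 vg.2); rewrite row_Div_mul_laplacian.
Qed.

Lemma row_Div_proj n (y : 'rV[L]_m) :
  Div_push (@cover_proj p l G hG _ n) (row_Div (map_mx (pr n.+1) y)) =
  row_Div (map_mx (pr n) y).
Proof.
rewrite (row_Div_push (@Gquo_proj p l G hG n)) -map_mx_comp; congr row_Div.
by apply: eq_map_mx => a /=; rewrite Lambda_projP.
Qed.

Fact row_Pic_subproof (y : 'rV[L]_m) n :
  Pic_push (Xn n) (@cover_proj _ _ _ hG _ n)
    (Pic_class (Xn n.+1) (row_Div (map_mx (pr n.+1) y))) =
  Pic_class (Xn n) (row_Div (map_mx (pr n) y)).
Proof. by rewrite cover_pushE row_Div_proj. Qed.

Definition row_Pic (y : 'rV[L]_m) : Pinf := MkPicInfty (row_Pic_subproof y).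

Fact row_Pic_is_linear : linear row_Pic.
Proof.
move=> a y z; apply: Pic_infty_eq => n.
rewrite /= cover_actE -Pic_classD map_mxD map_mxZ row_DivD row_Div_act //.
Qed.
HB.instance Definition _ := GRing.isLinear.Build _ _ _ _ row_Pic row_Pic_is_linear.

(** A representative of the class at level [n.+1] pushes to [d] up to a principal divisor, and
    principal divisors lift. *)
Lemma Pic_lift_step (c : Pinf) n (d : Div _ p_pr) : Pic_class (Xn n) d = c n ->
  exists d' : Div _ p_pr, Pic_class (Xn n.+1) d' = c n.+1 /\
    Div_push (@cover_proj _ _ _ hG _ n) d' = d.
Proof.
move=> dc; have := Pic_compP c n; rewrite -dc => /Pic_classP/asboolP[a aE].
have [s sP] := choice (@Gquo_proj_surj _ _ _ hG n).
(* The lift applies a set-theoretic section [s] to the base points of the [delta]; by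
   [Div_push_delta] it pushes down to the given principal divisor. *)
pose w := \sum_vg a vg *: delta (Xn n.+1) p_pr (vg.1, s vg.2).
exists (Pic_rep (c n.+1) - w); split.
  rewrite -[RHS]Pic_repK; apply/Pic_classP.
  rewrite addrAC subrr sub0r rpredN; apply: rpred_sum => vg _.
  exact/PrZ/Pr_delta.
rewrite Div_pushD Div_pushN; apply/eqP; rewrite subr_eq -subr_eq0 opprD addrA subr_eq0.
apply/eqP; rewrite aE /w Div_push_sum; apply: eq_bigr => -[v g] _.
rewrite Div_pushZ /=; congr (_ *: _).
have := Div_push_delta p_pr X (fun e => @Gquo_proj_cls p l G hG n (alpha e))
  (@Gquo_projM p l G hG n) (v, s g).
by rewrite /= sP => <-.
Qed.

Lemma row_Pic_surj (c : Pinf) : exists y, row_Pic y = c.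
Proof.
have step n (d : {d : Div _ p_pr | Pic_class (Xn n) d = c n}) :
    {d' : {d' : Div _ p_pr | Pic_class (Xn n.+1) d' = c n.+1} |
      Div_push (@cover_proj p l G hG _ n) (sval d') = sval d}.
  by apply: cid; have [d' [d'c d'd]] := Pic_lift_step (svalP d); exists (exist _ d' d'c).
(* Dependent choice: a compatible sequence of divisors representing [c], built upwards from level
   0. *)
pose d := nat_rect _
  (exist _ _ (Pic_repK (c 0%N)) : {d : Div _ p_pr | Pic_class (Xn 0) d = c 0%N})
  (fun n d => sval (step n d)).
have dP n : Div_push (@cover_proj p l G hG _ n) (sval (d n.+1)) = sval (d n).
  exact: (svalP (step n (d n))).
have [r rE] : exists r : forall n, 'rV[galg Zp (Gquo hG n)]_m,
    forall n, row_Div (r n) = sval (d n).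
  exists (fun n => sval (cid (row_Div_surj (sval (d n))))) => n.
  exact: (svalP (cid (row_Div_surj (sval (d n))))).
have rP n : map_mx (galg_push (@Gquo_proj p l G hG n)) (r n.+1) = r n.
  by apply: row_Div_inj; rewrite -row_Div_push rE [RHS]rE; apply: dP.
have /choice[y yP] : forall i, exists a : L, forall n, pr n a = r n 0 i.
  by move=> i; apply: Lambda_lift => n; rewrite -[in RHS]rP mxE.
exists (\row_i y i); apply: Pic_infty_eq => n /=.
rewrite -(svalP (d n)) -rE; congr (Pic_class _ (row_Div _)).
by apply/rowP => i; rewrite !mxE.
Qed.

Lemma row_Pic_ker (y : 'rV[L]_m) :
  row_Pic y = 0 <-> exists x : 'rV[L]_m, y = x *m hom_mx laplacian.
Proof.
pose Q n := map_mx (pr n) (hom_mx laplacian).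
have levelwise : row_Pic y = 0 <->
    forall n, exists x : 'rV_m, map_mx (pr n) y = x *m Q n.
  have row0 n : row_Pic y n = 0 <-> exists x : 'rV_m, map_mx (pr n) y = x *m Q n.
    rewrite -row_Div_Pr /= -Pic_class0 -[X in X \in _]subr0.
    exact: Pic_classP.
  split=> [y0 n|xP]; first by apply/row0; rewrite y0.
  by apply: Pic_infty_eq => n; apply/row0.
split=> [/levelwise xP|[x yx]]; last first.
  by apply/levelwise => n; exists (map_mx (pr n) x); rewrite yx map_mxM.
(* Solutions chosen separately at each level, hence not yet compatible. *)
have [x {}xP] : exists x : forall N, 'rV[galg Zp (Gquo hG N)]_m,
    forall N, map_mx (pr N) y = x N *m Q N.
  by exists (fun N => sval (cid (xP N))) => N; apply: (svalP (cid (xP N))).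
(* The level-[N] solution seen at level [n]. It is meaningful only for [n <= N]; the limit over [N]
   ignores the other indices. *)
pose xp n N := map_mx (galg_push (@quo_proj G (Gsub_n hG N) (Gsub_n hG n))) (x N).
have xpP n N : (n <= N)%N -> map_mx (pr n) y = xp n N *m Q n.
  move=> nN; rewrite -(subnK nN); set k := (N - n)%N.
  have projM : {morph @quo_proj G (Gsub_n hG (k + n)) (Gsub_n hG n) : u v / (u * v)%g}.
    by move=> u v; apply: quo_projM; apply: Gsub_mono.
  have projE (a : L) : pr n a = galg_push_hom projM (pr (k + n)%N a).
    by rewrite -(Lambda_proj_mono hG a n k).
  have -> : Q n = map_mx (galg_push_hom projM) (Q (k + n)%N).
    by rewrite -map_mx_comp; apply: eq_map_mx => a; apply: projE.
  rewrite /xp -[map_mx (galg_push _) _]/(map_mx (galg_push_hom projM) _) -map_mxM -xP.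
  by rewrite -map_mx_comp; apply: eq_map_mx => a; apply: projE.
have xpS n N : (n < N)%N -> map_mx (galg_push (@Gquo_proj p l G hG n)) (xp n.+1 N) = xp n N.
  move=> nN; rewrite /xp -map_mx_comp; apply: eq_map_mx => a /=.
  apply: galg_push_quo; last exact: Gsub_sub.
  by rewrite -(subnK nN); apply: Gsub_mono.
have [lim [limD limM lim_cst lim_eq]] := ultralimit_exists p_pr.
have lim_sum (I : finType) (P : pred I) (F : I -> nat -> Zp) :
    lim (fun N => \sum_(i | P i) F i N) = \sum_(i | P i) lim (F i).
  have -> : \sum_(i | P i) lim (F i) =
      lim (\big[(fun u v N => u N + v N)/(fun=> 0)]_(i | P i) F i).
    by elim/big_rec2: _ => [|i u v _ ->]; rewrite ?lim_cst ?limD.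
  congr lim; apply/funext => N.
  by elim/big_rec2: _ => // i u v _ ->.
pose xl n : 'rV[galg Zp (Gquo hG n)]_m := \row_i [ffun g => lim (fun N => xp n N 0 i g)].
have xlS n : map_mx (galg_push (@Gquo_proj p l G hG n)) (xl n.+1) = xl n.
  apply/rowP => i; apply/ffunP => g; rewrite !mxE !ffunE.
  under eq_bigr => h _ do rewrite ffunE.
  rewrite -lim_sum; apply: (lim_eq _ _ n.+1) => N nN.
  by rewrite -(xpS n N nN) [in RHS]mxE ffunE.
have xlP n : map_mx (pr n) y = xl n *m Q n.
  apply/rowP => j; apply/ffunP => g.
  rewrite -[LHS]lim_cst [(xl n *m Q n) 0 j]mxE sum_ffunE.
  transitivity (lim (fun N => (xp n N *m Q n) 0 j g)).
    by apply: (lim_eq _ _ n) => N nN; rewrite -xpP.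
  (* Each coefficient of the product is a finite combination of coefficients of [xp n N], with
     multipliers independent of [N], so the limit passes through. *)
  transitivity (\sum_i \sum_h lim (fun N => Q n i j (h^-1 * g)%g * xp n N 0 i h)).
    rewrite -[RHS](eq_bigr _ (fun i _ => lim_sum _ _ _)) -lim_sum; congr lim.
    apply/funext => N.
    rewrite mxE sum_ffunE; apply: eq_bigr => i _; rewrite ffunE.
    by apply: eq_bigr => h _; rewrite mulrC.
  apply: eq_bigr => i _; rewrite ffunE; apply: eq_bigr => h _.
  by rewrite limM mulrC [xl n 0 i]mxE ffunE.
have /choice[z zP] : forall i, exists a : L, forall n, pr n a = xl n 0 i.
  by move=> i; apply: Lambda_lift => n; rewrite -[in RHS]xlS [RHS]mxE.
exists (\row_i z i); apply/rowP => i; apply: (@Lambda_proj_inj _ _ _ _ hG) => n.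
have /rowP/(_ i) := xlP n; rewrite mxE => ->.
rewrite [LHS]mxE [in RHS]mxE rmorph_sum; apply: eq_bigr => j _.
rewrite [RHS]rmorphM [Q n j i]mxE; congr (_ * _) => /=.
by rewrite [in RHS]mxE zP.
Qed.

Lemma laplacian_presents : presents Pinf laplacian.
Proof. by exists row_Pic; split; [exact: row_Pic_surj|exact: row_Pic_ker]. Qed.

End Presentation.

Theorem theorem1p1 (p : nat) (p_pr : prime p) (l : nat) (G : profiniteGroupType)
    (hG : is_uniform p l G) (m : nat) (S : finType) (X : graph 'I_m S)
    (alpha : S -> G) :
  graph_connected X ->
  (forall n : nat, graph_connected (voltage_cover hG X alpha n)) ->
  Fitt hG (Pic_infty p_pr hG X alpha) =
  principal_I hG (Nrd_Lambda hG (degree_mx p_pr G X - (voltage_mx p_pr X alpha)^T)).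
Proof.
(* A vertex exists, so the presentation has positive size, as [Fitt] demands. *)
move=> [V_gt0 _] _; apply: (Fitt_quadratic hG); first by rewrite card_ord in V_gt0.
exact: laplacian_presents.
Qed.
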